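(* (In $\mathbf{ZF}$.) Let $\mathbf{X}$ be a Cantor completely metrizable space. (i) If $\mathbf{X}$ is second-countable, then every $G_\delta$-subspace of $\mathbf{X}$ is Loeb, so also separable. (ii) If $\mathbf{X}$ is Loeb and has a cuf base, then every $G_\delta$-subspace of $\mathbf{X}$ is Loeb and separable.
   Context: The result is a theorem of $\mathbf{ZF}$ (Zermelo–Fraenkel set theory without the axiom of choice). A set is countable if it is equipotent with a subset of $\omega$. A set is a cuf set if it is expressible as a countable union of finite sets. A topological space has a cuf base if it has an open base which is a cuf set. A topological space is Loeb if the family of all its non-empty closed subsets has a choice function. For a metric $d$ on $X$, $\tau(d)$ is the topology induced by $d$ and $\delta_d(A)=\sup\{d(x,y):x,y\in A\}$. A metric $d$ on $X$ is Cantor complete if, for every descending family $\{F_n:n\in\omega\}$ of non-empty closed subsets of $\langle X,\tau(d)\rangle$ with $\lim_{n\to+\infty}\delta_d(F_n)=0$, we have $\bigcap_{n\in\omega}F_n\neq\emptyset$. A topological space $\langle X,\tau\rangle$ is Cantor completely metrizable if there is a Cantor complete metric $d$ on $X$ with $\tau=\tau(d)$. A $G_\delta$-subspace is a subspace whose underlying set is a countable intersection of open sets of the space. *)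

(* Defs.v *)
(** The theorem is about what ZF proves without the axiom of choice, so it is
    stated for an arbitrary first-order model of ZF: all the sets, functions,
    natural numbers and reals below are elements of that model.  The schemas
    range over first-order formulas only.  Allowing arbitrary predicates
    [M -> Prop] would let choice in the metatheory give choice in the model. *)

Set Implicit Arguments.
Unset Strict Implicit.
Unset Printing Implicit Defensive.

Record set_structure := SetStructure {
  carrier :> Type;
  mem : carrier -> carrier -> Prop }.

Notation "x ∈ y" := (mem x y) (at level 70, no associativity).
Notation "x ∉ y" := (~ mem x y) (at level 70, no associativity).

(** Variables are de Bruijn indices into an environment [nat -> M], which also
    supplies the parameters of the schemas. *)

Inductive formula : Set :=
| fMem (i j : nat)
| fEq (i j : nat)
| fBot
| fImp (p q : formula)
| fAnd (p q : formula)
| fOr (p q : formula)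
| fAll (p : formula)
| fEx (p : formula).

Definition scons (T : Type) (x : T) (e : nat -> T) (n : nat) : T :=
  match n with
  | O => x
  | S k => e k
  end.

Fixpoint sat (M : set_structure) (e : nat -> M) (p : formula) : Prop :=
  match p with
  | fMem i j => e i ∈ e j
  | fEq i j => e i = e j
  | fBot => False
  | fImp p q => sat e p -> sat e q
  | fAnd p q => sat e p /\ sat e q
  | fOr p q => sat e p \/ sat e q
  | fAll p => forall x : M, sat (scons x e) p
  | fEx p => exists x : M, sat (scons x e) p
  end.

Definition subset (M : set_structure) (a b : M) : Prop :=
  forall x : M, x ∈ a -> x ∈ b.

Notation "a ⊆ b" := (subset a b) (at level 70, no associativity).

Definition nonempty (M : set_structure) (a : M) : Prop :=
  exists x : M, x ∈ a.

Definition is_empty (M : set_structure) (a : M) : Prop :=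
  forall x : M, x ∉ a.

Definition is_upair (M : set_structure) (a x y : M) : Prop :=
  forall z : M, z ∈ a <-> z = x \/ z = y.

Definition is_union (M : set_structure) (u a : M) : Prop :=
  forall x : M, x ∈ u <-> exists y : M, y ∈ a /\ x ∈ y.

Definition is_inter (M : set_structure) (c a b : M) : Prop :=
  forall x : M, x ∈ c <-> x ∈ a /\ x ∈ b.

Definition is_diff (M : set_structure) (c a b : M) : Prop :=
  forall x : M, x ∈ c <-> x ∈ a /\ x ∉ b.

(** [s = n ∪ {n}] *)
Definition is_succ (M : set_structure) (s n : M) : Prop :=
  forall x : M, x ∈ s <-> x ∈ n \/ x = n.

Definition inductive_set (M : set_structure) (a : M) : Prop :=
  (exists z : M, is_empty z /\ z ∈ a) /\
  (forall n : M, n ∈ a -> exists s : M, is_succ s n /\ s ∈ a).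

Record models_ZF (M : set_structure) : Prop := ModelsZF {
  zf_extensionality :
    forall a b : M, (forall x : M, x ∈ a <-> x ∈ b) -> a = b;
  zf_pairing :
    forall x y : M, exists a : M, is_upair a x y;
  zf_union :
    forall a : M, exists u : M, is_union u a;
  zf_powerset :
    forall a : M, exists p : M, forall b : M, b ∈ p <-> b ⊆ a;
  zf_infinity :
    exists a : M, inductive_set a;
  zf_foundation :
    forall a : M, nonempty a ->
    exists x : M, x ∈ a /\ forall y : M, y ∈ a -> y ∉ x;
  zf_separation :
    forall (p : formula) (e : nat -> M) (a : M),
    exists b : M, forall x : M, x ∈ b <-> x ∈ a /\ sat (scons x e) p;
  zf_replacement :
    forall (p : formula) (e : nat -> M) (a : M),
    (forall x y z : M, x ∈ a ->
      sat (scons x (scons y e)) p -> sat (scons x (scons z e)) p -> y = z) ->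
    exists b : M, forall y : M,
      y ∈ b <-> exists x : M, x ∈ a /\ sat (scons x (scons y e)) p }.

(** Kuratowski: [p = {{x}, {x, y}}] *)
Definition is_opair (M : set_structure) (p x y : M) : Prop :=
  forall z : M, z ∈ p <-> is_upair z x x \/ is_upair z x y.

Definition is_prod (M : set_structure) (c a b : M) : Prop :=
  forall p : M,
    p ∈ c <-> exists x y : M, x ∈ a /\ y ∈ b /\ is_opair p x y.

(** [⟨x, y⟩ ∈ r]; for a function [r] this reads [r(x) = y]. *)
Definition rel (M : set_structure) (r x y : M) : Prop :=
  exists p : M, is_opair p x y /\ p ∈ r.

(** [⟨⟨x, y⟩, z⟩ ∈ f], that is [f(x, y) = z] *)
Definition rel2 (M : set_structure) (f x y z : M) : Prop :=
  exists p : M, is_opair p x y /\ rel f p z.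

Definition is_function (M : set_structure) (f a b : M) : Prop :=
  (forall p : M, p ∈ f ->
     exists x y : M, x ∈ a /\ y ∈ b /\ is_opair p x y) /\
  (forall x : M, x ∈ a -> exists! y : M, rel f x y).

Definition is_function2 (M : set_structure) (f a b : M) : Prop :=
  exists c : M, is_prod c a a /\ is_function f c b.

Definition is_bijection (M : set_structure) (f a b : M) : Prop :=
  is_function f a b /\
  (forall y : M, y ∈ b -> exists! x : M, rel f x y).

Definition equipotent (M : set_structure) (a b : M) : Prop :=
  exists f : M, is_bijection f a b.

Definition is_omega (M : set_structure) (w : M) : Prop :=
  inductive_set w /\ forall a : M, inductive_set a -> w ⊆ a.

Definition finite (M : set_structure) (a : M) : Prop :=
  exists w n : M, is_omega w /\ n ∈ w /\ equipotent a n.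

Definition countable (M : set_structure) (a : M) : Prop :=
  exists w s : M, is_omega w /\ s ⊆ w /\ equipotent a s.

Definition cuf (M : set_structure) (a : M) : Prop :=
  exists F : M,
    countable F /\ (forall b : M, b ∈ F -> finite b) /\ is_union a F.

Definition has_choice_function (M : set_structure) (K : M) : Prop :=
  exists u f : M, is_union u K /\ is_function f K u /\
    forall C x : M, C ∈ K -> rel f C x -> x ∈ C.

Record real_structure (M : set_structure) := RealStructure {
  rset : M;
  radd : M;
  rmul : M;
  rle : M;
  r0 : M;
  r1 : M }.

Definition Rle (M : set_structure) (R : real_structure M) (x y : M) : Prop :=
  rel (rle R) x y.

Definition Rlt (M : set_structure) (R : real_structure M) (x y : M) : Prop :=
  Rle R x y /\ x <> y.

Definition Radd (M : set_structure) (R : real_structure M) (x y z : M) : Prop :=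
  rel2 (radd R) x y z.

Definition Rmul (M : set_structure) (R : real_structure M) (x y z : M) : Prop :=
  rel2 (rmul R) x y z.

Definition upper_bound (M : set_structure) (R : real_structure M)
    (S u : M) : Prop :=
  u ∈ rset R /\ forall x : M, x ∈ S -> Rle R x u.

Definition is_sup (M : set_structure) (R : real_structure M)
    (S s : M) : Prop :=
  upper_bound R S s /\ forall u : M, upper_bound R S u -> Rle R s u.

(** The reals are any Dedekind-complete ordered field of the model; ZF proves that
    one exists and that it is unique up to isomorphism. *)
Record is_real_field (M : set_structure) (R : real_structure M) : Prop :=
  IsRealField {
  r0_in : r0 R ∈ rset R;
  r1_in : r1 R ∈ rset R;
  r1_neq_r0 : r1 R <> r0 R;
  radd_fun : is_function2 (radd R) (rset R) (rset R);
  rmul_fun : is_function2 (rmul R) (rset R) (rset R);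
  radd_assoc : forall x y z a b c : M,
    Radd R x y a -> Radd R a z b -> Radd R y z c -> Radd R x c b;
  radd_comm : forall x y a : M, Radd R x y a -> Radd R y x a;
  radd_0 : forall x : M, x ∈ rset R -> Radd R x (r0 R) x;
  radd_opp : forall x : M, x ∈ rset R ->
    exists y : M, y ∈ rset R /\ Radd R x y (r0 R);
  rmul_assoc : forall x y z a b c : M,
    Rmul R x y a -> Rmul R a z b -> Rmul R y z c -> Rmul R x c b;
  rmul_comm : forall x y a : M, Rmul R x y a -> Rmul R y x a;
  rmul_1 : forall x : M, x ∈ rset R -> Rmul R x (r1 R) x;
  rmul_inv : forall x : M, x ∈ rset R -> x <> r0 R ->
    exists y : M, y ∈ rset R /\ Rmul R x y (r1 R);
  rmul_add : forall x y z a b c d : M,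
    Radd R y z a -> Rmul R x a b -> Rmul R x y c -> Rmul R x z d ->
    Radd R c d b;
  rle_in : forall p : M, p ∈ rle R ->
    exists x y : M, x ∈ rset R /\ y ∈ rset R /\ is_opair p x y;
  rle_refl : forall x : M, x ∈ rset R -> Rle R x x;
  rle_antisym : forall x y : M, Rle R x y -> Rle R y x -> x = y;
  rle_trans : forall x y z : M, Rle R x y -> Rle R y z -> Rle R x z;
  rle_total : forall x y : M, x ∈ rset R -> y ∈ rset R ->
    Rle R x y \/ Rle R y x;
  rle_add : forall x y z a b : M,
    Rle R x y -> Radd R x z a -> Radd R y z b -> Rle R a b;
  rle_mul : forall x y a : M,
    Rle R (r0 R) x -> Rle R (r0 R) y -> Rmul R x y a -> Rle R (r0 R) a;
  r_complete : forall S : M, S ⊆ rset R -> nonempty S ->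
    (exists u : M, upper_bound R S u) -> exists s : M, is_sup R S s }.

Record topological_space (M : set_structure) (X T : M) : Prop :=
  TopologicalSpace {
  open_subset : forall U : M, U ∈ T -> U ⊆ X;
  open_empty : forall U : M, is_empty U -> U ∈ T;
  open_whole : X ∈ T;
  open_union : forall F U : M, F ⊆ T -> is_union U F -> U ∈ T;
  open_inter : forall U V W : M,
    U ∈ T -> V ∈ T -> is_inter W U V -> W ∈ T }.

Definition closed_in (M : set_structure) (X T C : M) : Prop :=
  C ⊆ X /\ exists U : M, is_diff U X C /\ U ∈ T.

Definition open_base (M : set_structure) (T B : M) : Prop :=
  B ⊆ T /\
  forall U : M, U ∈ T -> exists F : M, F ⊆ B /\ is_union U F.

Definition second_countable (M : set_structure) (T : M) : Prop :=
  exists B : M, open_base T B /\ countable B.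

Definition has_cuf_base (M : set_structure) (T : M) : Prop :=
  exists B : M, open_base T B /\ cuf B.

Definition separable (M : set_structure) (X T : M) : Prop :=
  exists D : M, D ⊆ X /\ countable D /\
    forall U : M, U ∈ T -> nonempty U -> exists x : M, x ∈ U /\ x ∈ D.

Definition loeb (M : set_structure) (X T : M) : Prop :=
  exists K : M,
    (forall C : M, C ∈ K <-> closed_in X T C /\ nonempty C) /\
    has_choice_function K.

Definition g_delta (M : set_structure) (X T A : M) : Prop :=
  exists G : M, G ⊆ T /\ countable G /\
    forall x : M, x ∈ A <-> x ∈ X /\ forall U : M, U ∈ G -> x ∈ U.

Definition subspace_topology (M : set_structure) (T A S : M) : Prop :=
  forall V : M, V ∈ S <-> exists U : M, U ∈ T /\ is_inter V U A.

Record is_metric (M : set_structure) (R : real_structure M) (X d : M) : Prop :=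
  IsMetric {
  metric_fun : is_function2 d X (rset R);
  metric_ge0 : forall x y r : M, rel2 d x y r -> Rle R (r0 R) r;
  metric_eq0 : forall x y : M, x ∈ X -> y ∈ X ->
    (rel2 d x y (r0 R) <-> x = y);
  metric_sym : forall x y r : M, rel2 d x y r -> rel2 d y x r;
  metric_triangle : forall x y z a b c s : M,
    rel2 d x z a -> rel2 d x y b -> rel2 d y z c -> Radd R b c s ->
    Rle R a s }.

Definition metric_topology (M : set_structure) (R : real_structure M)
    (X d T : M) : Prop :=
  forall U : M, U ∈ T <->
    U ⊆ X /\
    forall x : M, x ∈ U ->
      exists eps : M, eps ∈ rset R /\ Rlt R (r0 R) eps /\
        forall y r : M, y ∈ X -> rel2 d x y r -> Rlt R r eps -> y ∈ U.

(** [δ_d(A) = s] with [s] real; no [s] satisfies this when [δ_d(A) = +∞]. *)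
Definition is_diameter (M : set_structure) (R : real_structure M)
    (d A s : M) : Prop :=
  exists S : M,
    (forall r : M, r ∈ S <->
       exists x y : M, x ∈ A /\ y ∈ A /\ rel2 d x y r) /\
    is_sup R S s.

Definition diameters_tend_to_0 (M : set_structure) (R : real_structure M)
    (d w F : M) : Prop :=
  forall eps : M, eps ∈ rset R -> Rlt R (r0 R) eps ->
    exists m : M, m ∈ w /\
      forall n C : M, n ∈ w -> m ∈ n \/ m = n -> rel F n C ->
        exists s : M, is_diameter R d C s /\ Rlt R s eps.

(** The family [{F_n : n ∈ ω}] is a function [F] on [w = ω] in the model. *)
Definition cantor_complete (M : set_structure) (R : real_structure M)
    (X d : M) : Prop :=
  forall T w F K : M,
    metric_topology R X d T ->
    is_omega w ->
    is_function F w K ->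
    (forall n C : M, n ∈ w -> rel F n C -> closed_in X T C /\ nonempty C) ->
    (forall n m C D : M, n ∈ w -> is_succ m n -> rel F n C -> rel F m D ->
       D ⊆ C) ->
    diameters_tend_to_0 R d w F ->
    exists x : M, forall n C : M, n ∈ w -> rel F n C -> x ∈ C.

Definition cantor_completely_metrizable (M : set_structure)
    (R : real_structure M) (X T : M) : Prop :=
  exists d : M,
    is_metric R X d /\ cantor_complete R X d /\ metric_topology R X d T.

(* Main.v *)
Require Import Defs.
From Stdlib Require Import Arith Lia Classical ClassicalEpsilon Setoid.

(** Let [d] be a Cantor complete metric on [X] and let [A] be the intersection of a
    countable family [G] of open sets.  Suppose that [X] has a base [B] from whose
    non-empty subfamilies a function [sel] chooses.  Then a point is chosen from
    each non-empty relatively closed [C ⊆ A] by recursion: start with [X], and let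
    [sel] pick a basic open set that meets [C], whose closure lies in the previous
    set and in the [n]-th member of [G], and whose closure has diameter at most
    [h n], where [h] is a fixed sequence of positive reals tending to 0.  The
    closures of the traces on [C] are closed, decreasing and of diameter tending to
    0, so by completeness they have exactly one common point.  It lies in every
    member of [G], hence in [A], and in the closure of [C], hence in [C]
    ([limit_point_in]).  So [A] is Loeb.

    If a subspace [A] has a choice function for its non-empty closed subsets, and
    [X] has a base which is a countable union of finite sets, then the points
    chosen from the closures of the traces of basic sets are dense in [A].  They
    form a countable union of finite sets, and the same function chooses from
    non-empty finite subsets of [A], since these are closed.  That makes the union
    countable ([countable_union_of_finite], [separable_of_chooses]).

    In (i) the function [sel] takes the member of least index.  In (ii) the previous
    paragraph, applied to [X] itself, gives a countable dense set; the balls with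
    centres in it and radii [h n] form a base, and [sel] minimises the index of the
    centre and then [n] ([separable_selects]).

    Since all of this happens inside a model, every property used in separation,
    replacement, induction or recursion must be given by a first-order formula with
    parameters.  This is the predicate [Def] on relations between elements of the
    model; it is closed under the connectives, quantifiers, definable terms and
    definite descriptions, and the tactic [df] applies these closure properties.
    Definite descriptions make it possible to name sets of the model by terms. *)

Set Implicit Arguments.
Unset Strict Implicit.
Unset Printing Implicit Defensive.

(** * Definable predicates and terms *)

(** Renaming of the free variables of a formula. *)
Fixpoint ren (r : nat -> nat) (p : formula) : formula :=
  let up := fun n => match n with O => O | S k => S (r k) end in
  match p with
  | fMem i j => fMem (r i) (r j)
  | fEq i j => fEq (r i) (r j)
  | fBot => fBot
  | fImp p q => fImp (ren r p) (ren r q)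
  | fAnd p q => fAnd (ren r p) (ren r q)
  | fOr p q => fOr (ren r p) (ren r q)
  | fAll p => fAll (ren up p)
  | fEx p => fEx (ren up p)
  end.

Section Definability.
Context (M : set_structure).
Notation env := (nat -> M).

Lemma sat_ext (p : formula) : forall e e' : env,
  (forall n, e n = e' n) -> (sat e p <-> sat e' p).
Proof.
induction p; intros e e' H; cbn.
- rewrite (H i), (H j); tauto.
- rewrite (H i), (H j); tauto.
- tauto.
- rewrite (IHp1 e e' H), (IHp2 e e' H); tauto.
- rewrite (IHp1 e e' H), (IHp2 e e' H); tauto.
- rewrite (IHp1 e e' H), (IHp2 e e' H); tauto.
- assert (K : forall x, sat (scons x e) p <-> sat (scons x e') p)
    by (intros x; apply IHp; intros [|n]; cbn; auto).
  firstorder.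
- assert (K : forall x, sat (scons x e) p <-> sat (scons x e') p)
    by (intros x; apply IHp; intros [|n]; cbn; auto).
  firstorder.
Qed.

Lemma sat_ren (p : formula) : forall (r : nat -> nat) (e : env),
  sat e (ren r p) <-> sat (fun n => e (r n)) p.
Proof.
induction p; intros r e; cbn; try tauto.
- rewrite IHp1, IHp2; tauto.
- rewrite IHp1, IHp2; tauto.
- rewrite IHp1, IHp2; tauto.
- assert (K : forall x, sat (scons x e)
      (ren (fun n => match n with O => O | S k => S (r k) end) p)
      <-> sat (scons x (fun n => e (r n))) p)
    by (intros x; rewrite IHp; apply sat_ext; intros [|n]; reflexivity).
  firstorder.
- assert (K : forall x, sat (scons x e)
      (ren (fun n => match n with O => O | S k => S (r k) end) p)
      <-> sat (scons x (fun n => e (r n))) p)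
    by (intros x; rewrite IHp; apply sat_ext; intros [|n]; reflexivity).
  firstorder.
Qed.

(** The environment in which a formula with parameters is read: [rho] sends each
    of its variables either to an argument or to a parameter in [M]. *)
Definition ev (rho : nat -> nat + M) (e : env) (n : nat) : M :=
  match rho n with inl i => e i | inr a => a end.

(** A relation, with its arguments given as an environment, is definable when a
    first-order formula with parameters in [M] expresses it. *)
Definition Def (P : env -> Prop) : Prop :=
  exists (p : formula) (rho : nat -> nat + M),
    forall e, P e <-> sat (ev rho e) p.

(** A term is definable when its graph is. *)
Definition DefT (t : env -> M) : Prop :=
  Def (fun e => e 0 = t (fun n => e (S n))).

Lemma def_iff (P Q : env -> Prop) :
  (forall e, P e <-> Q e) -> Def P -> Def Q.
Proof.
intros H [p [rho Hp]]; exists p, rho; intros e; rewrite <- H; apply Hp.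
Qed.

Lemma def_ren (f : nat -> nat) (P : env -> Prop) :
  Def P -> Def (fun e => P (fun n => e (f n))).
Proof.
intros [p [rho Hp]].
exists p, (fun n => match rho n with inl i => inl (f i) | inr a => inr a end).
intros e; rewrite Hp; apply sat_ext; intros n; unfold ev.
destruct (rho n); reflexivity.
Qed.

(* The variables of the two formulas are renamed to even and odd numbers, so that
   each keeps its own parameters. *)
Lemma def_binop (op : formula -> formula -> formula)
    (bop : Prop -> Prop -> Prop)
    (Hop : forall p q (e : env), sat e (op p q) <-> bop (sat e p) (sat e q))
    (Hb : forall A B A' B', (A <-> A') -> (B <-> B') -> (bop A B <-> bop A' B'))
    (P Q : env -> Prop) :
  Def P -> Def Q -> Def (fun e => bop (P e) (Q e)).
Proof.
intros [p [r1 Hp]] [q [r2 Hq]].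
exists (op (ren (fun n => n + n) p) (ren (fun n => S (n + n)) q)).
exists (fun n => if Nat.even n then r1 (Nat.div2 n) else r2 (Nat.div2 n)).
intros e; rewrite Hop; apply Hb.
- rewrite Hp, sat_ren; apply sat_ext; intros n; unfold ev.
  replace (n + n) with (2 * n) by lia.
  rewrite Nat.even_mul; cbn [orb Nat.even].
  rewrite Nat.div2_double; reflexivity.
- rewrite Hq, sat_ren; apply sat_ext; intros n; unfold ev.
  replace (S (n + n)) with (S (2 * n)) by lia.
  rewrite Nat.even_succ, Nat.odd_mul; cbn [andb Nat.odd Nat.even negb].
  rewrite Nat.div2_succ_double; reflexivity.
Qed.

Lemma def_and (P Q : env -> Prop) :
  Def P -> Def Q -> Def (fun e => P e /\ Q e).
Proof. apply (def_binop (op := fAnd)); [reflexivity | tauto]. Qed.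

Lemma def_or (P Q : env -> Prop) :
  Def P -> Def Q -> Def (fun e => P e \/ Q e).
Proof. apply (def_binop (op := fOr)); [reflexivity | tauto]. Qed.

Lemma def_imp (P Q : env -> Prop) :
  Def P -> Def Q -> Def (fun e => P e -> Q e).
Proof.
apply (def_binop (op := fImp) (bop := fun A B => A -> B));
  [reflexivity | tauto].
Qed.

Lemma def_equiv (P Q : env -> Prop) :
  Def P -> Def Q -> Def (fun e => P e <-> Q e).
Proof. intros HP HQ; apply def_and; apply def_imp; assumption. Qed.

Lemma def_false : Def (fun _ => False).
Proof. exists fBot, inl; intros e; reflexivity. Qed.

Lemma def_not (P : env -> Prop) : Def P -> Def (fun e => ~ P e).
Proof. intros HP; apply def_imp; [assumption | apply def_false]. Qed.

(** Renaming that turns the argument 0 into the variable bound by a quantifier, and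
    the reading of the other variables under that quantifier. *)
Definition bind (rho : nat -> nat + M) (n : nat) : nat :=
  match rho n with inl O => O | _ => S n end.
Definition bind_env (rho : nat -> nat + M) (n : nat) : nat + M :=
  match rho n with inl (S i) => inl i | r => r end.

Lemma sat_bind (p : formula) rho e x :
  sat (scons x (ev (bind_env rho) e)) (ren (bind rho) p) <->
  sat (ev rho (scons x e)) p.
Proof.
rewrite sat_ren; apply sat_ext; intros n; unfold bind, ev, bind_env.
destruct (rho n) as [[|i]|a] eqn:E; cbn; rewrite ?E; reflexivity.
Qed.

Lemma def_all (Q : env -> M -> Prop) :
  Def (fun e => Q (fun n => e (S n)) (e 0)) -> Def (fun e => forall x, Q e x).
Proof.
intros [p [rho Hp]].
exists (fAll (ren (bind rho) p)), (bind_env rho); intros e; cbn.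
split; intros H x; specialize (H x).
- rewrite sat_bind, <- Hp; exact H.
- rewrite sat_bind, <- Hp in H; exact H.
Qed.

Lemma def_ex (Q : env -> M -> Prop) :
  Def (fun e => Q (fun n => e (S n)) (e 0)) -> Def (fun e => exists x, Q e x).
Proof.
intros [p [rho Hp]].
exists (fEx (ren (bind rho) p)), (bind_env rho); intros e; cbn.
split; intros [x H]; exists x.
- rewrite sat_bind, <- Hp; exact H.
- rewrite sat_bind, <- Hp in H; exact H.
Qed.

Lemma defT_var (k : nat) : DefT (fun e => e k).
Proof.
exists (fEq 0 1), (fun n => match n with O => inl 0 | _ => inl (S k) end).
intros e; reflexivity.
Qed.

Lemma defT_const (a : M) : DefT (fun _ => a).
Proof.
exists (fEq 0 1), (fun n => match n with O => inl 0 | _ => inr a end).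
intros e; reflexivity.
Qed.

Lemma defT_ren (f : nat -> nat) (t : env -> M) :
  DefT t -> DefT (fun e => t (fun n => e (f n))).
Proof.
intros Ht.
exact (def_ren (fun n => match n with O => O | S k => S (f k) end) Ht).
Qed.

Lemma def_subst (t : env -> M) (Q : env -> M -> Prop) :
  DefT t -> Def (fun e => Q (fun n => e (S n)) (e 0)) ->
  Def (fun e => Q e (t e)).
Proof.
intros Ht HQ.
apply (@def_iff (fun e => exists x, x = t e /\ Q e x)).
- intros e; split; [intros [x [-> H]]; exact H | eauto].
- apply def_ex, def_and; assumption.
Qed.

Lemma defT_subst (t : env -> M) (f : env -> M -> M) :
  DefT t -> DefT (fun e => f (fun n => e (S n)) (e 0)) ->
  DefT (fun e => f e (t e)).
Proof.
intros Ht Hf.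
refine (@def_subst (fun e => t (fun n => e (S n)))
  (fun e x => e 0 = f (fun n => e (S n)) x) _ _).
- exact (defT_ren S Ht).
- exact (def_ren (fun n => match n with 0 => 1 | 1 => 0 | S (S k) => S (S k) end)
    Hf).
Qed.

(** Definable relations and operations of a fixed arity. *)
Definition D1 (P : M -> Prop) := Def (fun e => P (e 0)).
Definition D2 (P : M -> M -> Prop) := Def (fun e => P (e 0) (e 1)).
Definition D3 (P : M -> M -> M -> Prop) := Def (fun e => P (e 0) (e 1) (e 2)).
Definition T1 (f : M -> M) := DefT (fun e => f (e 0)).
Definition T2 (f : M -> M -> M) := DefT (fun e => f (e 0) (e 1)).
Definition T3 (f : M -> M -> M -> M) := DefT (fun e => f (e 0) (e 1) (e 2)).

Lemma D1_app P a : D1 P -> DefT a -> Def (fun e => P (a e)).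
Proof.
intros HP Ha.
refine (def_subst (Q := fun e x => P x) Ha _); exact HP.
Qed.

Lemma D2_app P a b : D2 P -> DefT a -> DefT b -> Def (fun e => P (a e) (b e)).
Proof.
intros HP Ha Hb.
refine (def_subst (Q := fun e x => P (a e) x) Hb _).
refine (def_subst (t := fun e => a (fun n => e (S n)))
  (Q := fun e x => P x (e 0)) (defT_ren S Ha) _).
exact HP.
Qed.

Lemma D3_app P a b c : D3 P -> DefT a -> DefT b -> DefT c ->
  Def (fun e => P (a e) (b e) (c e)).
Proof.
intros HP Ha Hb Hc.
refine (def_subst (Q := fun e x => P (a e) (b e) x) Hc _).
refine (def_subst (t := fun e => b (fun n => e (S n)))
  (Q := fun e x => P (a (fun n => e (S n))) x (e 0)) (defT_ren S Hb) _).
refine (def_subst (t := fun e => a (fun n => e (S (S n))))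
  (Q := fun e x => P x (e 0) (e 1)) (defT_ren (fun n => S (S n)) Ha) _).
exact HP.
Qed.

Lemma T1_app f a : T1 f -> DefT a -> DefT (fun e => f (a e)).
Proof.
intros Hf Ha.
refine (defT_subst (f := fun e x => f x) Ha _); exact Hf.
Qed.

Lemma T2_app f a b : T2 f -> DefT a -> DefT b -> DefT (fun e => f (a e) (b e)).
Proof.
intros Hf Ha Hb.
refine (defT_subst (f := fun e x => f (a e) x) Hb _).
refine (defT_subst (t := fun e => a (fun n => e (S n)))
  (f := fun e x => f x (e 0)) (defT_ren S Ha) _).
exact Hf.
Qed.

Lemma T3_app f a b c : T3 f -> DefT a -> DefT b -> DefT c ->
  DefT (fun e => f (a e) (b e) (c e)).
Proof.
intros Hf Ha Hb Hc.
refine (defT_subst (f := fun e x => f (a e) (b e) x) Hc _).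
refine (defT_subst (t := fun e => b (fun n => e (S n)))
  (f := fun e x => f (a (fun n => e (S n))) x (e 0)) (defT_ren S Hb) _).
refine (defT_subst (t := fun e => a (fun n => e (S (S n))))
  (f := fun e x => f x (e 0) (e 1)) (defT_ren (fun n => S (S n)) Ha) _).
exact Hf.
Qed.

Lemma D2_mem : D2 (@mem M).
Proof. exists (fMem 0 1), inl; intros e; reflexivity. Qed.

Lemma D2_eq : D2 (@eq M).
Proof. exists (fEq 0 1), inl; intros e; reflexivity. Qed.

End Definability.

Create HintDb defs.
#[export] Hint Resolve D2_mem D2_eq : defs.

(* [df] proves definability by structural recursion on the expression: connectives
   and quantifiers first, then comprehension terms and abbreviations (the two
   tactics redefined below), then an application of a definable relation or
   operation, of the greatest arity that fits, to definable terms. *)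
Ltac df_leaf := first [assumption | solve [auto 3 with defs nocore]].
Ltac df_comprehension := fail.
Ltac df_unfold := fail.
Ltac df_step :=
  cbv beta;
  first
  [ lazymatch goal with
    | |- D1 _ => unfold D1 | |- D2 _ => unfold D2
    | |- D3 _ => unfold D3
    | |- T1 _ => unfold T1 | |- T2 _ => unfold T2 | |- T3 _ => unfold T3
    | |- Def (fun e => @?P e /\ @?Q e) => apply (@def_and _ P Q)
    | |- Def (fun e => @?P e \/ @?Q e) => apply (@def_or _ P Q)
    | |- Def (fun e => ~ @?P e) => apply (@def_not _ P)
    | |- Def (fun e => @?P e <-> @?Q e) => apply (@def_equiv _ P Q)
    | |- Def (fun e => @?P e -> @?Q e) => apply (@def_imp _ P Q)
    | |- Def (fun e => forall x, @?Q e x) => apply (@def_all _ Q)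
    | |- Def (fun e => exists x, @?Q e x) => apply (@def_ex _ Q)
    | |- DefT (fun e => e ?k) => apply defT_var
    | |- DefT (fun _ => ?a) => apply defT_const
    end
  | df_comprehension
  | df_unfold
  | lazymatch goal with
    | |- Def (fun e => ?P (@?a e) (@?b e) (@?c e)) =>
      apply (@D3_app _ P a b c); [df_leaf | ..]
    | |- DefT (fun e => ?P (@?a e) (@?b e) (@?c e)) =>
      apply (@T3_app _ P a b c); [df_leaf | ..] end
  | lazymatch goal with
    | |- Def (fun e => ?P (@?a e) (@?b e)) =>
      apply (@D2_app _ P a b); [df_leaf | ..]
    | |- DefT (fun e => ?P (@?a e) (@?b e)) =>
      apply (@T2_app _ P a b); [df_leaf | ..] end
  | lazymatch goal with
    | |- Def (fun e => ?P (@?a e)) =>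
      apply (@D1_app _ P a); [df_leaf | ..]
    | |- DefT (fun e => ?P (@?a e)) =>
      apply (@T1_app _ P a); [df_leaf | ..] end ].
Ltac df := repeat df_step.

Section DefinedNotions.
Context (M : set_structure).

Lemma D2_subset : D2 (@subset M).
Proof. unfold subset; df. Qed.
Lemma D1_nonempty : D1 (@nonempty M).
Proof. unfold nonempty; df. Qed.
Lemma D3_is_upair : D3 (@is_upair M).
Proof. unfold is_upair; df. Qed.
Lemma D2_is_union : D2 (@is_union M).
Proof. unfold is_union; df. Qed.
#[local] Hint Resolve D3_is_upair : defs.
Lemma D3_is_opair : D3 (@is_opair M).
Proof. unfold is_opair; df. Qed.
#[local] Hint Resolve D3_is_opair : defs.
Lemma D3_rel : D3 (@rel M).
Proof. unfold rel; df. Qed.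
#[local] Hint Resolve D3_rel : defs.
End DefinedNotions.

#[export] Hint Resolve D2_subset D1_nonempty D3_is_upair D2_is_union
  D3_is_opair D3_rel : defs.

(** * Set theory in the model *)

(* The axioms of the model are an implicit argument of the operations below. *)
Existing Class models_ZF.

Section Comprehension.
Context {M : set_structure} {HM : models_ZF M}.
Notation env := (nat -> M).

Lemma ext_eq (a b : M) : (forall x, x ∈ a <-> x ∈ b) -> a = b.
Proof. apply (zf_extensionality HM). Qed.

Lemma separation (P : M -> Prop) (a : M) :
  D1 P -> exists b : M, forall x, x ∈ b <-> x ∈ a /\ P x.
Proof.
intros [p [rho Hp]].
destruct (zf_separation HM (ren (bind rho) p)
  (ev (bind_env rho) (fun _ => a)) a) as [b Hb].
exists b; intros x; rewrite Hb, sat_bind, <- Hp; reflexivity.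
Qed.

Lemma replacement (Q : M -> M -> Prop) (a : M) :
  D2 Q -> (forall x y z, x ∈ a -> Q x y -> Q x z -> y = z) ->
  exists b : M, forall y, y ∈ b <-> exists x, x ∈ a /\ Q x y.
Proof.
intros [p [rho Hp]] Hf.
set (q := ren (fun n => match rho n with
  inl 0 => 0 | inl 1 => 1 | _ => S (S n) end) p).
set (e := fun n => match rho n with inr c => c | inl _ => a end).
assert (K : forall x y, sat (scons x (scons y e)) q <-> Q x y).
{ intros x y; rewrite (Hp (scons x (scons y (fun _ => a)))); unfold q.
  rewrite sat_ren; apply sat_ext; intros n; unfold ev, e.
  destruct (rho n) as [[|[|i]]|c] eqn:E; cbn; rewrite ?E; reflexivity. }
destruct (zf_replacement HM (p := q) (e := e) (a := a)) as [b Hb].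
- intros x y z Hx; rewrite !K; apply Hf; exact Hx.
- exists b; intros y; rewrite Hb; setoid_rewrite K; reflexivity.
Qed.

Lemma exists_empty : exists z : M, is_empty z.
Proof.
destruct (zf_infinity HM) as [a [[z [Hz _]] _]]; exists z; exact Hz.
Qed.

Definition emp : M := proj1_sig (constructive_indefinite_description _ exists_empty).

Lemma in_emp x : ~ x ∈ emp.
Proof.
apply (proj2_sig (constructive_indefinite_description _ exists_empty)).
Qed.

(** The element with the property [P] if there is exactly one, otherwise the
    empty set; this default makes descriptions of definable properties definable. *)
Definition iota (P : M -> Prop) : M :=
  epsilon (inhabits emp)
    (fun x => unique P x \/ (~ (exists x, unique P x) /\ x = emp)).

Lemma iota_char (P : M -> Prop) :
  unique P (iota P) \/ (~ (exists x, unique P x) /\ iota P = emp).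
Proof.
unfold iota; apply (epsilon_spec (inhabits emp)
  (fun x => unique P x \/ (~ (exists x, unique P x) /\ x = emp))).
destruct (classic (exists x, unique P x)) as [[x Hx]|H]; eauto.
Qed.

Lemma iota_spec (P : M -> Prop) : (exists! x, P x) -> P (iota P).
Proof.
intros H; destruct (iota_char P) as [[K _]|[K _]]; [exact K | contradiction].
Qed.

Lemma iota_eq (P : M -> Prop) x :
  P x -> (forall y, P y -> y = x) -> iota P = x.
Proof.
intros Hx H; apply H, iota_spec; exists x; split; [exact Hx|].
intros y Hy; symmetry; auto.
Qed.

Lemma defT_iota (P : env -> M -> Prop) :
  Def (fun e => P (fun n => e (S n)) (e 0)) -> DefT (fun e => iota (P e)).
Proof.
intros HP.
apply (@def_iff M (fun e => unique (P (fun n => e (S n))) (e 0) \/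
  (~ (exists x, unique (P (fun n => e (S n))) x) /\ e 0 = emp))).
- intros e; destruct (iota_char (P (fun n => e (S n)))) as [H|[H E]].
  + split.
    * intros [K|[K _]]; [symmetry; apply H, K | exfalso; eauto].
    * intros ->; auto.
  + rewrite E; split; [intros [K|[_ K]]; [exfalso; eauto | exact K] | auto].
- assert (K : forall f, Def (fun e => P (fun n => e (S (f n))) (e 0))).
  { intros f; exact (def_ren
      (fun n => match n with 0 => 0 | S k => S (f k) end) HP). }
  assert (U : Def (fun e => unique (P (fun n => e (S n))) (e 0))).
  { unfold unique; apply def_and; [exact HP|].
    apply def_all, def_imp; [exact (K S) | df]. }
  apply def_or; [exact U|].
  apply def_and; [|df].
  apply def_not, def_ex.
  exact (def_ren (fun n => match n with 0 => 0 | S k => S (S k) end) U).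
Qed.

(** [{x ∈ a | P x}] *)
Definition sep (a : M) (P : M -> Prop) : M :=
  iota (fun b => forall x, x ∈ b <-> x ∈ a /\ P x).

Lemma in_sep a P x : D1 P -> (x ∈ sep a P <-> x ∈ a /\ P x).
Proof.
intros HP; revert x.
apply (@iota_spec (fun b => forall x, x ∈ b <-> x ∈ a /\ P x)).
destruct (separation a HP) as [b Hb]; exists b; split; [exact Hb|].
intros c Hc; apply ext_eq; intros x; rewrite Hb, Hc; reflexivity.
Qed.

Lemma defT_sep (a : env -> M) (P : env -> M -> Prop) :
  DefT a -> Def (fun e => P (fun n => e (S n)) (e 0)) ->
  DefT (fun e => sep (a e) (P e)).
Proof.
intros Ha HP; apply defT_iota, def_all, def_equiv; [df|].
apply def_and.
- apply D2_app; [df_leaf | df | exact (defT_ren (fun n => S (S n)) Ha)].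
- exact (def_ren (fun n => match n with 0 => 0 | S k => S (S k) end) HP).
Qed.

(** [{g x | x ∈ a}] *)
Definition img (a : M) (g : M -> M) : M :=
  iota (fun b => forall y, y ∈ b <-> exists x, x ∈ a /\ y = g x).

Lemma in_img a g y : T1 g -> (y ∈ img a g <-> exists x, x ∈ a /\ y = g x).
Proof.
intros Hg; revert y.
apply (@iota_spec (fun b => forall y, y ∈ b <-> exists x, x ∈ a /\ y = g x)).
destruct (@replacement (fun x y => y = g x) a) as [b Hb].
- df.
- intros x y z _ -> ->; reflexivity.
- exists b; split; [exact Hb|].
  intros c Hc; apply ext_eq; intros y; rewrite Hb, Hc; reflexivity.
Qed.

Lemma defT_img (a : env -> M) (g : env -> M -> M) :
  DefT a -> DefT (fun e => g (fun n => e (S n)) (e 0)) ->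
  DefT (fun e => img (a e) (g e)).
Proof.
intros Ha Hg; apply defT_iota, def_all, def_equiv; [df|].
apply def_ex, def_and.
- apply D2_app; [df_leaf | df |].
  exact (defT_ren (fun n => S (S (S n))) Ha).
- exact (def_ren (fun n => match n with
    0 => 1 | 1 => 0 | S (S k) => S (S (S k)) end) Hg).
Qed.

End Comprehension.

Arguments emp {M HM}.

Ltac df_comprehension ::=
  lazymatch goal with
  | |- Def (fun e => ex (unique (fun x => @?Q e x))) =>
    change (Def (fun e => exists x, unique (fun y => Q e y) x))
  | |- Def (fun e => unique (fun y => @?Q e y) (@?x e)) =>
    change (Def (fun e => Q e (x e) /\ forall y, Q e y -> x e = y))
  | |- DefT (fun e => iota (@?P e)) => apply (@defT_iota _ _ P)
  | |- DefT (fun e => sep (@?a e) (@?P e)) => apply (@defT_sep _ _ a P)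
  | |- DefT (fun e => img (@?a e) (@?g e)) => apply (@defT_img _ _ a g)
  end.

(* Rewriting with membership in a comprehension, discharging its definability. *)
Tactic Notation "rsep" := rewrite in_sep by (df).
Tactic Notation "rsep" "in" hyp(H) := rewrite in_sep in H by (df).
Tactic Notation "rimg" := rewrite in_img by (df).
Tactic Notation "rimg" "in" hyp(H) := rewrite in_img in H by (df).

Section Operations.
Context {M : set_structure} {HM : models_ZF M}.
Implicit Types a b f x y z : M.

(** [op x y] is the ordered pair, [app f x] the value of the function [f] at [x]
    (empty unless [f] has exactly one value there), and [lam a g] the function with domain [a] and values [g x]. *)
Definition upair x y : M := iota (fun a => is_upair a x y).
Definition union a : M := iota (fun u => is_union u a).
Definition power a : M := iota (fun p => forall b, b ∈ p <-> b ⊆ a).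
Definition sing x : M := upair x x.
Definition cup a b : M := union (upair a b).
Definition op x y : M := upair (sing x) (upair x y).
Definition diff a b : M := sep a (fun x => x ∉ b).
Definition cap a b : M := sep a (fun x => x ∈ b).
Definition app f x : M := iota (fun y => op x y ∈ f).
Definition lam a (g : M -> M) : M := img a (fun x => op x (g x)).

Lemma T2_upair : T2 upair.
Proof. unfold upair; df. Qed.
Lemma T1_union : T1 union.
Proof. unfold union; df. Qed.
#[local] Hint Resolve T2_upair T1_union : defs.
Lemma T1_sing : T1 sing.
Proof. unfold sing; df. Qed.
Lemma T2_cup : T2 cup.
Proof. unfold cup; df. Qed.
#[local] Hint Resolve T1_sing : defs.
Lemma T2_op : T2 op.
Proof. unfold op; df. Qed.
Lemma T2_diff : T2 diff.
Proof. unfold diff; df. Qed.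
Lemma T2_cap : T2 cap.
Proof. unfold cap; df. Qed.
#[local] Hint Resolve T2_op : defs.
Lemma T2_app_set : T2 app.
Proof. unfold app; df. Qed.

Lemma in_upair x y z : z ∈ upair x y <-> z = x \/ z = y.
Proof.
revert z; apply (@iota_spec M HM (fun a => is_upair a x y)).
destruct (zf_pairing HM x y) as [a Ha]; exists a; split; [exact Ha|].
intros b Hb; apply ext_eq; intros z; rewrite (Ha z), (Hb z); reflexivity.
Qed.

Lemma in_union a x : x ∈ union a <-> exists y, y ∈ a /\ x ∈ y.
Proof.
revert x; apply (@iota_spec M HM (fun u => is_union u a)).
destruct (zf_union HM a) as [u Hu]; exists u; split; [exact Hu|].
intros b Hb; apply ext_eq; intros z; rewrite (Hu z), (Hb z); reflexivity.
Qed.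

Lemma in_power a x : x ∈ power a <-> x ⊆ a.
Proof.
revert x; apply (@iota_spec M HM (fun p => forall b, b ∈ p <-> b ⊆ a)).
destruct (zf_powerset HM a) as [p Hp]; exists p; split; [exact Hp|].
intros b Hb; apply ext_eq; intros z; rewrite (Hp z), (Hb z); reflexivity.
Qed.

Lemma in_sing x z : z ∈ sing x <-> z = x.
Proof. unfold sing; rewrite in_upair; tauto. Qed.

Lemma in_cup a b x : x ∈ cup a b <-> x ∈ a \/ x ∈ b.
Proof.
unfold cup; rewrite in_union; split.
- intros [y [Hy Hx]]; rewrite in_upair in Hy.
  destruct Hy as [-> | ->]; auto.
- intros [H|H]; [exists a | exists b]; rewrite in_upair; auto.
Qed.

Lemma in_diff a b x : x ∈ diff a b <-> x ∈ a /\ x ∉ b.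
Proof. unfold diff; rsep; reflexivity. Qed.

Lemma in_cap a b x : x ∈ cap a b <-> x ∈ a /\ x ∈ b.
Proof. unfold cap; rsep; reflexivity. Qed.

Lemma is_upair_eq a x y : is_upair a x y <-> a = upair x y.
Proof.
split.
- intros H; apply ext_eq; intros z; rewrite in_upair; apply H.
- intros -> z; apply in_upair.
Qed.

Lemma is_opair_eq p x y : is_opair p x y <-> p = op x y.
Proof.
unfold is_opair; setoid_rewrite is_upair_eq; split.
- intros H; apply ext_eq; intros z; unfold op; rewrite in_upair; apply H.
- intros -> z; apply in_upair.
Qed.

Lemma op_inj x y x' y' : op x y = op x' y' -> x = x' /\ y = y'.
Proof.
intros H.
assert (K : forall z, (z = sing x \/ z = upair x y) <->
                      (z = sing x' \/ z = upair x' y')).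
{ intros z; rewrite <- !in_upair; change (z ∈ op x y <-> z ∈ op x' y').
  rewrite H; reflexivity. }
assert (S : forall u v w, sing u = upair v w -> u = v /\ u = w).
{ intros u v w E; split; symmetry; apply in_sing; rewrite E, in_upair; auto. }
assert (Ex : x = x').
{ destruct (proj1 (K (sing x)) (or_introl eq_refl)) as [E|E].
  - apply (S x x' x') in E; tauto.
  - apply S in E; tauto. }
subst x'; split; [reflexivity|].
assert (Q' : y' = x \/ y' = y).
{ destruct (proj2 (K (upair x y')) (or_intror eq_refl)) as [E|E].
  - symmetry in E; apply S in E; left; symmetry; apply E.
  - rewrite <- in_upair, <- E, in_upair; auto. }
destruct (proj1 (K (upair x y)) (or_intror eq_refl)) as [E|E].
- symmetry in E; apply S in E; destruct E as [_ E]; destruct Q'; congruence.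
- assert (Q : y ∈ upair x y') by (rewrite <- E, in_upair; auto).
  rewrite in_upair in Q; destruct Q, Q'; congruence.
Qed.

Lemma rel_op r x y : rel r x y <-> op x y ∈ r.
Proof.
unfold rel; setoid_rewrite is_opair_eq; split.
- intros [p [-> H]]; exact H.
- intros H; eauto.
Qed.

Lemma rel2_op r x y z : rel2 r x y z <-> op (op x y) z ∈ r.
Proof.
unfold rel2; setoid_rewrite is_opair_eq; setoid_rewrite rel_op; split.
- intros [p [-> H]]; exact H.
- intros H; eauto.
Qed.

Lemma app_spec f a b x : is_function f a b -> x ∈ a ->
  (forall y, op x y ∈ f <-> y = app f x) /\ app f x ∈ b.
Proof.
intros [Hf Hu] Hx; destruct (Hu x Hx) as [y [Hy Hy']].
setoid_rewrite rel_op in Hy'; rewrite rel_op in Hy.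
assert (E : app f x = y).
{ apply iota_eq; [exact Hy | intros z Hz; symmetry; auto]. }
rewrite E; split.
- intros z; split; [intros Hz; symmetry; auto | intros ->; exact Hy].
- destruct (Hf _ Hy) as [u [v [_ [Hv Hp]]]].
  rewrite is_opair_eq in Hp; apply op_inj in Hp; destruct Hp as [_ ->].
  exact Hv.
Qed.

Lemma lam_function a b (g : M -> M) : T1 g -> (forall x, x ∈ a -> g x ∈ b) ->
  is_function (lam a g) a b.
Proof.
intros Hg Hb; split.
- intros p Hp; unfold lam in Hp; rimg in Hp; destruct Hp as [x [Hx ->]].
  exists x, (g x); rewrite is_opair_eq; auto.
- intros x Hx; exists (g x); unfold lam; split.
  + rewrite rel_op; rimg; eauto.
  + intros y; rewrite rel_op; rimg; intros [x' [_ E]].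
    apply op_inj in E; destruct E as [-> ->]; reflexivity.
Qed.

Lemma rel_lam a (g : M -> M) x y : T1 g ->
  (rel (lam a g) x y <-> x ∈ a /\ y = g x).
Proof.
intros Hg; rewrite rel_op; unfold lam; rimg; split.
- intros [x' [Hx E]]; apply op_inj in E; destruct E as [-> ->]; auto.
- intros [Hx ->]; eauto.
Qed.

Lemma nonempty_or_emp a : a = emp \/ nonempty a.
Proof.
destruct (classic (nonempty a)) as [H|H]; [auto|left].
apply ext_eq; intros x; split; intros Hx; [|destruct (in_emp Hx)].
exfalso; apply H; exists x; exact Hx.
Qed.

Lemma subset_antisym a b : a ⊆ b -> b ⊆ a -> a = b.
Proof. intros H K; apply ext_eq; intros x; split; auto. Qed.

End Operations.

#[export] Hint Resolve T2_upair T1_union T1_sing T2_cup T2_op T2_diff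
  T2_cap T2_app_set : defs.

(** * Natural numbers of the model *)

Section Omega.
Context {M : set_structure} {HM : models_ZF M}.
Implicit Types k m n x : M.

Definition succ n : M := cup n (sing n).

Lemma T1_succ : T1 succ.
Proof. unfold succ; df. Qed.
#[local] Hint Resolve T1_succ : defs.

Lemma in_succ n x : x ∈ succ n <-> x ∈ n \/ x = n.
Proof. unfold succ; rewrite in_cup, in_sing; reflexivity. Qed.

Lemma is_succ_eq s n : is_succ s n <-> s = succ n.
Proof.
split.
- intros H; apply ext_eq; intros x; rewrite in_succ; apply H.
- intros -> x; apply in_succ.
Qed.

Lemma is_empty_eq (z : M) : is_empty z <-> z = emp.
Proof.
split; [|intros ->; exact (@in_emp M HM)].
intros H; destruct (nonempty_or_emp z) as [E|[x Hx]]; [exact E|].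
destruct (H x Hx).
Qed.

Lemma inductive_set_eq (a : M) :
  inductive_set a <-> emp ∈ a /\ forall n, n ∈ a -> succ n ∈ a.
Proof.
unfold inductive_set; setoid_rewrite is_empty_eq; setoid_rewrite is_succ_eq.
split; intros [H1 H2]; split.
- destruct H1 as [z [-> H]]; exact H.
- intros n Hn; destruct (H2 n Hn) as [s [-> H]]; exact H.
- eauto.
- eauto.
Qed.

Lemma exists_omega : exists w : M, is_omega w.
Proof.
destruct (zf_infinity HM) as [a Ha].
set (w := sep a (fun x => forall b : M,
  (emp ∈ b /\ forall n, n ∈ b -> succ n ∈ b) -> x ∈ b)).
assert (Hw : forall x, x ∈ w <-> x ∈ a /\ forall b : M,
  (emp ∈ b /\ forall n, n ∈ b -> succ n ∈ b) -> x ∈ b).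
{ intros x; unfold w; rsep; reflexivity. }
exists w; split.
- rewrite inductive_set_eq in *; split.
  + rewrite Hw; split; [apply Ha | intros b Hb; apply Hb].
  + intros n Hn; rewrite Hw in Hn; destruct Hn as [Hn Hb].
    rewrite Hw; split; [apply Ha, Hn|].
    intros b [H0 HS]; apply HS, Hb; auto.
- intros b Hb x Hx; rewrite Hw in Hx; apply Hx, inductive_set_eq, Hb.
Qed.

Definition omega : M := proj1_sig (constructive_indefinite_description _ exists_omega).

Lemma omega_is_omega : is_omega omega.
Proof.
exact (proj2_sig (constructive_indefinite_description _ exists_omega)).
Qed.

Lemma is_omega_eq (w : M) : is_omega w <-> w = omega.
Proof.
split; [|intros ->; apply omega_is_omega].
intros [H1 H2]; destruct omega_is_omega as [H3 H4].
apply subset_antisym; auto.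
Qed.

Lemma emp_in_omega : emp ∈ omega.
Proof.
destruct omega_is_omega as [H _]; apply inductive_set_eq in H; apply H.
Qed.

Lemma succ_in_omega n : n ∈ omega -> succ n ∈ omega.
Proof.
destruct omega_is_omega as [H _]; apply inductive_set_eq in H; apply H.
Qed.

Lemma omega_ind (P : M -> Prop) : D1 P -> P emp ->
  (forall n, n ∈ omega -> P n -> P (succ n)) -> forall n, n ∈ omega -> P n.
Proof.
intros HP H0 HS n Hn.
assert (K : inductive_set (sep omega P)).
{ apply inductive_set_eq; split.
  - rsep; split; [apply emp_in_omega | exact H0].
  - intros m Hm; rsep in Hm; destruct Hm as [Hm Hm'].
    rsep; split; [apply succ_in_omega; exact Hm | auto]. }
destruct omega_is_omega as [_ H]; specialize (H _ K _ Hn).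
rsep in H; apply H.
Qed.

End Omega.

#[export] Hint Resolve T1_succ : defs.

(* Induction on a natural number of the model; [df] proves the property definable. *)
Ltac nat_ind :=
  lazymatch goal with
  | |- forall n, n ∈ omega -> @?P n =>
    apply (@omega_ind _ _ P); [df | cbv beta | cbv beta]
  end.

Section OmegaOrder.
Context {M : set_structure} {HM : models_ZF M}.
Implicit Types k m n x : M.

Lemma not_in_self n : ~ n ∈ n.
Proof.
destruct (zf_foundation HM (a := sing n)) as [x [Hx H]].
- exists n; apply in_sing; reflexivity.
- apply in_sing in Hx; subst x; intros K; apply (H n); [|exact K].
  apply in_sing; reflexivity.
Qed.

Lemma omega_trans n : n ∈ omega ->
  n ⊆ omega /\ forall m k, k ∈ m -> m ∈ n -> k ∈ n.
Proof.
revert n; nat_ind.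
- split; [intros x Hx | intros m k _ Hx]; destruct (in_emp Hx).
- intros n Hn [IH1 IH2]; split.
  + intros x Hx; apply in_succ in Hx; destruct Hx as [Hx| ->]; auto.
  + intros m k Hk Hm; apply in_succ in Hm; apply in_succ.
    destruct Hm as [Hm| ->]; eauto.
Qed.

Lemma in_omega n m : n ∈ omega -> m ∈ n -> m ∈ omega.
Proof. intros Hn; apply omega_trans; exact Hn. Qed.

Lemma mem_trans n m k : n ∈ omega -> k ∈ m -> m ∈ n -> k ∈ n.
Proof. intros Hn; apply omega_trans; exact Hn. Qed.

Lemma succ_inj n m : n ∈ omega -> succ n = succ m -> n = m.
Proof.
intros Hn E.
assert (H1 : n ∈ succ m) by (rewrite <- E; apply in_succ; auto).
assert (H2 : m ∈ succ n) by (rewrite E; apply in_succ; auto).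
apply in_succ in H1; apply in_succ in H2.
destruct H1 as [H1|H1]; [|exact H1]; destruct H2 as [H2|H2]; [|auto].
destruct (@not_in_self n); apply (mem_trans Hn H1 H2).
Qed.

Lemma succ_neq_emp n : succ n <> emp.
Proof.
intros E; apply (@in_emp M HM n); rewrite <- E; apply in_succ; auto.
Qed.

Lemma emp_or_in n : n ∈ omega -> n = emp \/ emp ∈ n.
Proof.
revert n; nat_ind; [auto|].
intros n Hn [->|IH]; right; apply in_succ; auto.
Qed.

Lemma succ_mem_succ m : m ∈ omega -> forall n, n ∈ m -> succ n ∈ succ m.
Proof.
revert m; nat_ind.
- intros n Hn; destruct (in_emp Hn).
- intros m Hm IH n Hn; apply in_succ in Hn; apply in_succ.
  destruct Hn as [Hn| ->]; auto.
Qed.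

Lemma omega_trichotomy n : n ∈ omega ->
  forall m, m ∈ omega -> n ∈ m \/ n = m \/ m ∈ n.
Proof.
revert n; nat_ind.
- intros m Hm; destruct (emp_or_in Hm); auto.
- intros n Hn IH m Hm; destruct (IH m Hm) as [H|[-> |H]].
  + apply (succ_mem_succ Hm) in H; apply in_succ in H; tauto.
  + right; right; apply in_succ; auto.
  + right; right; apply in_succ; auto.
Qed.

(** The least natural number with the property [P], and 0 if there is none. *)
Definition least (P : M -> Prop) : M :=
  iota (fun n => n ∈ omega /\ P n /\ forall m, m ∈ n -> ~ P m).

Lemma least_spec (P : M -> Prop) : D1 P -> (exists n, n ∈ omega /\ P n) ->
  least P ∈ omega /\ P (least P) /\ forall m, m ∈ least P -> ~ P m.
Proof.
intros HP [n [Hn Pn]]; unfold least.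
apply (@iota_spec M HM
  (fun n => n ∈ omega /\ P n /\ forall m, m ∈ n -> ~ P m)).
destruct (zf_foundation HM (a := sep omega P)) as [k [Hk Hmin]].
- exists n; rsep; auto.
- rsep in Hk; destruct Hk as [Hk Pk].
  assert (Hl : forall m, m ∈ k -> ~ P m).
  { intros m Hm Pm; apply (Hmin m); [|exact Hm].
    rsep; split; [exact (in_omega Hk Hm) | exact Pm]. }
  exists k; split; [auto|].
  intros m [Hm [Pm Hm']].
  destruct (omega_trichotomy Hk Hm) as [H|[H|H]]; [|exact H|].
  + destruct (Hm' _ H Pk).
  + destruct (Hl _ H Pm).
Qed.

End OmegaOrder.

Ltac df_unfold ::=
  lazymatch goal with
  | |- DefT (fun e => least (@?P e)) => unfold least
  end.

(** * Recursion on the natural numbers of the model *)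

Section Recursion.
Context {M : set_structure} {HM : models_ZF M}.
Variables (z0 : M -> M) (h : M -> M -> M -> M).

(** [rec c n] is the [n]-th term of the sequence with first term [z0 c] and step
    [h c n], where [c] is a parameter.  [rec_rel c n y] says that [y] is that
    term: some set of pairs (index, value) contains [(n, y)], and each of its
    members either starts the sequence or follows from another member.  Such a set
    need not be a function. *)
Definition rec_rel (c n y : M) : Prop :=
  exists g : M, op n y ∈ g /\ forall p, p ∈ g -> p = op emp (z0 c) \/
    exists k z, k ∈ omega /\ op k z ∈ g /\ p = op (succ k) (h c k z).

Definition rec (c n : M) : M := iota (rec_rel c n).

Hypotheses (Hz0 : T1 z0) (Hh : T3 h).

Lemma T2_rec : T2 rec.
Proof. unfold rec, rec_rel; df. Qed.

Lemma rec_rel_unique (c n : M) : n ∈ omega -> exists! y, rec_rel c n y.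
Proof.
revert n; unfold rec_rel; nat_ind.
- exists (z0 c); split.
  + exists (sing (op emp (z0 c))); split; [apply in_sing; reflexivity|].
    intros p Hp; apply in_sing in Hp; auto.
  + intros y [g [Hy Hg]]; destruct (Hg _ Hy) as [E|[k [z [_ [_ E]]]]];
      apply op_inj in E; destruct E as [E ->]; [reflexivity|].
    symmetry in E; apply succ_neq_emp in E; contradiction.
- intros n Hn [y [[g [Hy Hg]] Hu]].
  exists (h c n y); split.
  + exists (cup g (sing (op (succ n) (h c n y)))); split.
    * apply in_cup; right; apply in_sing; reflexivity.
    * intros p Hp; apply in_cup in Hp; destruct Hp as [Hp|Hp].
      -- destruct (Hg p Hp) as [H|[k [z [Hk [Hz H]]]]]; [auto|right].
         exists k, z; rewrite in_cup; auto.
      -- apply in_sing in Hp; right; exists n, y; rewrite in_cup; auto.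
  + intros y' [g' [Hy' Hg']].
    destruct (Hg' _ Hy') as [E|[k [z [Hk [Hz E]]]]];
      apply op_inj in E; destruct E as [E ->].
    * apply succ_neq_emp in E; contradiction.
    * apply (succ_inj Hn) in E; subst k; f_equal; apply Hu; eauto.
Qed.

Lemma rec_0 (c : M) : rec c emp = z0 c.
Proof.
apply iota_eq.
- exists (sing (op emp (z0 c))); split; [apply in_sing; reflexivity|].
  intros p Hp; apply in_sing in Hp; auto.
- intros y [g [Hy Hg]]; destruct (Hg _ Hy) as [E|[k [z [_ [_ E]]]]];
    apply op_inj in E; destruct E as [E ->]; [reflexivity|].
  symmetry in E; apply succ_neq_emp in E; contradiction.
Qed.

Lemma rec_succ (c n : M) : n ∈ omega -> rec c (succ n) = h c n (rec c n).
Proof.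
intros Hn; pose proof (iota_spec (rec_rel_unique c (succ_in_omega Hn))) as H.
change (iota (rec_rel c (succ n))) with (rec c (succ n)) in H.
destruct H as [g [Hy Hg]].
destruct (Hg _ Hy) as [E|[k [z [Hk [Hz E]]]]];
  apply op_inj in E; destruct E as [E ->].
- apply succ_neq_emp in E; contradiction.
- apply (succ_inj Hn) in E; subst k; f_equal; symmetry; apply iota_eq.
  + exists g; auto.
  + intros y Hy'; destruct (rec_rel_unique c Hn) as [u [_ Hu]].
    rewrite <- (Hu y Hy'); apply Hu; exists g; auto.
Qed.

End Recursion.

#[export] Hint Extern 0 (T2 (rec _ _)) => apply T2_rec; df : defs.

(** * Finite and countable sets *)

Section Finite.
Context {M : set_structure} {HM : models_ZF M}.

(** Finiteness as an induction principle for definable properties: adding one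
    element of [a] at a time leads from the empty set to [a]. *)
Definition Fin (a : M) : Prop :=
  forall P : M -> Prop, D1 P -> P emp ->
  (forall Z x, Z ⊆ a -> x ∈ a -> P Z -> P (cup Z (sing x))) -> P a.

Lemma bijection_inj (f a b x y : M) : is_bijection f a b ->
  x ∈ a -> y ∈ a -> app f x = app f y -> x = y.
Proof.
intros [Hf Hb] Hx Hy E.
destruct (app_spec Hf Hx) as [Rx Bx]; destruct (app_spec Hf Hy) as [Ry _].
destruct (Hb _ Bx) as [u [_ Hu]].
rewrite <- (Hu x), <- (Hu y); [reflexivity| |];
  rewrite rel_op; [apply Ry; exact E | apply Rx; reflexivity].
Qed.

(* Induction on [i] for the part of [a] whose index is less than [i]. *)
Lemma finite_Fin (a : M) : finite a -> Fin a.
Proof.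
intros [w [n [Hw [Hn [f Hf]]]]] P HP H0 HS.
apply is_omega_eq in Hw; subst w.
assert (K : forall i, i ∈ omega -> P (sep a (fun x => app f x ∈ i))).
{ nat_ind.
  - replace (sep a (fun x => app f x ∈ emp)) with (@emp M HM); [exact H0|].
    apply ext_eq; intros x; rsep; split.
    + intros Hx; destruct (in_emp Hx).
    + intros [_ Hx]; destruct (in_emp Hx).
  - intros i Hi IH.
    destruct (classic (exists x, x ∈ a /\ app f x = i)) as [[x [Hx E]]|Hno].
    + replace (sep a (fun x => app f x ∈ succ i))
        with (cup (sep a (fun x => app f x ∈ i)) (sing x)).
      * apply HS; [|exact Hx|exact IH].
        intros y Hy; rsep in Hy; apply Hy.
      * apply ext_eq; intros y; rewrite in_cup, in_sing; rsep; rsep.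
        rewrite in_succ; split.
        -- intros [[Hy H]| ->]; auto.
        -- intros [Hy [H|H]]; [auto|right].
           apply (bijection_inj Hf); congruence.
    + replace (sep a (fun x => app f x ∈ succ i))
        with (sep a (fun x => app f x ∈ i)); [exact IH|].
      apply ext_eq; intros y; rsep; rsep; rewrite in_succ; split.
      * intros [Hy H]; auto.
      * intros [Hy [H|H]]; [auto|destruct Hno; eauto]. }
replace a with (sep a (fun x => app f x ∈ n)); [auto|].
apply ext_eq; intros x; rsep; split; [tauto|].
intros Hx; split; [exact Hx|]; apply (app_spec (proj1 Hf) Hx).
Qed.

Lemma Fin_img (a : M) (q : M -> Prop) (g : M -> M) :
  Fin a -> D1 q -> T1 g -> Fin (img (sep a q) g).
Proof.
intros Ha Hq Hg P HP H0 HS.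
enough (K : forall Z, Z = a -> P (img (sep Z q) g)) by (apply K; reflexivity).
assert (Hin : forall Z y, y ∈ img (sep Z q) g <->
  exists x, (x ∈ Z /\ q x) /\ y = g x).
{ intros Z y; rimg; setoid_rewrite in_sep; [reflexivity | df]. }
enough (K : P (img (sep a q) g)) by (intros Z ->; exact K).
apply (Ha (fun Z => P (img (sep Z q) g))); [df| |].
- replace (img (sep emp q) g) with (@emp M HM); [exact H0|].
  apply ext_eq; intros x; rewrite Hin; split.
  + intros Hx; destruct (in_emp Hx).
  + intros [y [[Hy _] _]]; destruct (in_emp Hy).
- intros Z x HZ Hx IH.
  destruct (classic (q x)) as [qx|qx].
  + replace (img (sep (cup Z (sing x)) q) g)
      with (cup (img (sep Z q) g) (sing (g x))).
    * apply HS; [| |exact IH].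
      -- intros y; rewrite !Hin; intros [z [[Hz qz] ->]]; eauto 6.
      -- rewrite Hin; eauto.
    * apply ext_eq; intros y; rewrite in_cup, in_sing, !Hin.
      setoid_rewrite in_cup; setoid_rewrite in_sing; split.
      -- intros [[z [[Hz qz] ->]]| ->]; eauto 6.
      -- intros [z [[[Hz| ->] qz] ->]]; eauto 6.
  + replace (img (sep (cup Z (sing x)) q) g) with (img (sep Z q) g);
      [exact IH|].
    apply ext_eq; intros y; rewrite !Hin.
    setoid_rewrite in_cup; setoid_rewrite in_sing; split.
    * intros [z [[Hz qz] ->]]; eauto 6.
    * intros [z [[[Hz| ->] qz] ->]]; [eauto 6 | contradiction].
Qed.

Lemma Fin_subset (a b : M) : Fin a -> b ⊆ a -> Fin b.
Proof.
intros Ha Hb.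
replace b with (img (sep a (fun x => x ∈ b)) (fun x => x)).
- apply Fin_img; [exact Ha | df | df].
- apply ext_eq; intros x; rimg; setoid_rewrite in_sep; [|df]; split.
  + intros [y [[_ Hy] ->]]; exact Hy.
  + intros Hx; exists x; auto.
Qed.

(** Tarski's form of finiteness: a non-empty family of subsets of a finite set has
    a minimal member. *)
Lemma Fin_minimal (a : M) : Fin a -> forall F : M, nonempty F ->
  (forall U, U ∈ F -> U ⊆ a) ->
  exists U, U ∈ F /\ forall V, V ∈ F -> V ⊆ U -> V = U.
Proof.
intros Ha.
apply (Ha (fun a => forall F : M, nonempty F ->
  (forall U, U ∈ F -> U ⊆ a) ->
  exists U, U ∈ F /\ forall V, V ∈ F -> V ⊆ U -> V = U)); [df| |].
- intros F [U HU] HF; exists U; split; [exact HU|].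
  intros V HV _; apply subset_antisym; intros x Hx;
    [apply (HF V HV) in Hx | apply (HF U HU) in Hx]; destruct (in_emp Hx).
- intros Z x HZ Hx IH F [U0 HU0] HF.
  destruct (classic (exists U, U ∈ F /\ x ∉ U)) as [[U [HU HxU]]|Hno].
  + destruct (IH (sep F (fun U => x ∉ U))) as [V [HV Hmin]].
    * exists U; rsep; auto.
    * intros V HV y Hy; rsep in HV; destruct HV as [HV HxV].
      pose proof (HF V HV y Hy) as K; apply in_cup in K.
      rewrite in_sing in K; destruct K as [K| ->]; [exact K | contradiction].
    * rsep in HV; destruct HV as [HV HxV]; exists V; split; [exact HV|].
      intros W HW HWV; apply Hmin; [|exact HWV]; rsep; auto.
  + assert (Hall : forall U, U ∈ F -> x ∈ U)
      by (intros U HU; apply NNPP; eauto).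
    destruct (IH (img F (fun U => diff U (sing x)))) as [V [HV Hmin]].
    * exists (diff U0 (sing x)); rimg; eauto.
    * intros V HV y Hy; rimg in HV; destruct HV as [U [HU ->]].
      apply in_diff in Hy; destruct Hy as [Hy Hyx].
      pose proof (HF U HU y Hy) as K; apply in_cup in K; tauto.
    * rimg in HV; destruct HV as [U [HU ->]]; exists U; split; [exact HU|].
      intros W HW HWU.
      assert (E : diff W (sing x) = diff U (sing x)).
      { apply Hmin; [rimg; eauto|].
        intros y; rewrite !in_diff; intros [H1 H2]; auto. }
      apply subset_antisym; [exact HWU|]; intros y Hy.
      destruct (classic (y = x)) as [-> |N]; [auto|].
      assert (K : y ∈ diff W (sing x))
        by (rewrite E, in_diff, in_sing; auto).
      apply in_diff in K; apply K.
Qed.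

Lemma countable_of_inj (a : M) (g : M -> M) : T1 g ->
  (forall x, x ∈ a -> g x ∈ omega) ->
  (forall x y, x ∈ a -> y ∈ a -> g x = g y -> x = y) -> countable a.
Proof.
intros Hg Hw Hinj.
exists omega, (img a g); split; [apply omega_is_omega|]; split.
- intros y Hy; rimg in Hy; destruct Hy as [x [Hx ->]]; auto.
- exists (lam a g); split.
  + apply lam_function; [exact Hg|]; intros x Hx; rimg; eauto.
  + intros y Hy; rimg in Hy; destruct Hy as [x [Hx ->]].
    exists x; split; [rewrite rel_lam by exact Hg; auto|].
    intros x'; rewrite rel_lam by exact Hg; intros [Hx' E]; auto.
Qed.

Lemma countable_inj (a : M) : countable a -> exists g : M -> M, T1 g /\
  (forall x, x ∈ a -> g x ∈ omega) /\
  (forall x y, x ∈ a -> y ∈ a -> g x = g y -> x = y).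
Proof.
intros [w [s [Hw [Hs [f Hf]]]]]; apply is_omega_eq in Hw; subst w.
exists (app f); split; [df|split].
- intros x Hx; apply Hs; apply (app_spec (proj1 Hf) Hx).
- intros x y; apply (bijection_inj Hf).
Qed.

(** Cuf sets and countable sets as unions of sequences of finite sets. *)
Lemma cuf_family (a : M) : cuf a -> exists D : M -> M, T1 D /\
  (forall n, n ∈ omega -> Fin (D n)) /\
  (forall x, x ∈ a <-> exists n, n ∈ omega /\ x ∈ D n).
Proof.
intros [F [HF [Hfin Hu]]]; destruct (countable_inj HF) as [g [Hg [Hw Hinj]]].
exists (fun n => sep a (fun x => exists b, b ∈ F /\ g b = n /\ x ∈ b)).
split; [df|split].
- intros n Hn.
  destruct (classic (exists b, b ∈ F /\ g b = n)) as [[b [Hb E]]|Hno].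
  + apply Fin_subset with b; [apply finite_Fin; auto|].
    intros x Hx; rsep in Hx; destruct Hx as [_ [b' [Hb' [E' Hx]]]].
    replace b with b'; [exact Hx | apply Hinj; congruence].
  + replace (sep a _) with (@emp M HM); [intros P HP H0 _; exact H0|].
    apply ext_eq; intros x; rsep; split; [intros Hx; destruct (in_emp Hx)|].
    intros [_ [b [Hb [E _]]]]; destruct Hno; eauto.
- intros x; setoid_rewrite in_sep; [|df]; split.
  + intros Hx; pose proof Hx as Hx'; apply Hu in Hx'.
    destruct Hx' as [b [Hb Hxb]]; exists (g b); split; eauto 6.
  + intros [n [_ [Hx _]]]; exact Hx.
Qed.

Lemma countable_family (a : M) : countable a -> exists D : M -> M, T1 D /\
  (forall n, n ∈ omega -> Fin (D n)) /\
  (forall x, x ∈ a <-> exists n, n ∈ omega /\ x ∈ D n).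
Proof.
intros Ha; destruct (countable_inj Ha) as [g [Hg [Hw Hinj]]].
exists (fun n => sep a (fun x => g x = n)); split; [df|split].
- intros n Hn P HP H0 HS.
  destruct (classic (exists x, x ∈ a /\ g x = n)) as [[x [Hx E]]|Hno].
  + assert (K : sep a (fun x => g x = n) = cup emp (sing x)).
    { apply ext_eq; intros y; rsep; rewrite in_cup, in_sing; split.
      - intros [Hy E']; right; apply Hinj; congruence.
      - intros [Hy| ->]; [destruct (in_emp Hy) | auto]. }
    rewrite K; apply HS; [| |exact H0].
    * intros y Hy; destruct (in_emp Hy).
    * rsep; auto.
  + replace (sep a _) with (@emp M HM); [exact H0|].
    apply ext_eq; intros x; rsep; split; [intros Hx; destruct (in_emp Hx)|].
    intros [Hx E]; destruct Hno; eauto.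
- intros x; setoid_rewrite in_sep; [|df]; split; [eauto|].
  intros [n [_ [Hx _]]]; exact Hx.
Qed.

End Finite.

Section CountableUnion.
Context {M : set_structure} {HM : models_ZF M}.
Variables (U : M) (D c : M -> M).
Hypotheses (HD : T1 D) (Hc : T1 c).
Hypothesis HU : forall x, x ∈ U <-> exists n, n ∈ omega /\ x ∈ D n.
Hypothesis Hfin : forall n, n ∈ omega -> Fin (D n).
Hypothesis Hchoice : forall n Z, n ∈ omega -> Z ⊆ D n -> nonempty Z -> c Z ∈ Z.

(** The part outside [E] of the first [D n] not included in [E]; it is empty when
    [E] includes them all, since [least] is then 0. *)
Definition missing (E : M) : M := diff (D (least (fun n => ~ D n ⊆ E))) E.

(** The chosen element of [missing E] is added; nothing is added when
    [missing E] is empty. *)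
Definition enum_step (E : M) : M := cup E (cap (sing (c (missing E))) (missing E)).

(** The set of elements enumerated in the first [k] steps. *)
Definition enum (k : M) : M := rec (fun _ => emp) (fun _ _ E => enum_step E) emp k.

Lemma T1_enum : T1 enum.
Proof. unfold enum, enum_step, missing; df. Qed.
#[local] Hint Resolve T1_enum : defs.

Lemma enum_0 : enum emp = emp.
Proof. exact (rec_0 (fun _ => emp) (fun _ _ E => enum_step E) emp). Qed.

Lemma enum_succ k : k ∈ omega -> enum (succ k) = enum_step (enum k).
Proof. 
apply (@rec_succ M HM (fun _ => emp) (fun _ _ E => enum_step E)).
unfold enum_step, missing; df.
Qed.

Lemma enum_mono l : l ∈ omega -> forall k, k ∈ l -> enum k ⊆ enum l.
Proof.
revert l; nat_ind.
- intros k Hk; destruct (in_emp Hk).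
- intros l Hl IH k Hk x Hx; rewrite enum_succ by exact Hl.
  apply in_cup; left; apply in_succ in Hk; destruct Hk as [Hk| ->];
    [apply (IH k Hk x Hx) | exact Hx].
Qed.

(** Each [D n] is exhausted.  Once the earlier sets are, the elements missing from
    [D m] form a decreasing sequence of subsets of a finite set, and the sequence
    strictly decreases as long as something is missing. *)
Lemma enum_covers m : m ∈ omega ->
  exists k, k ∈ omega /\ forall j, j ∈ m -> D j ⊆ enum k.
Proof.
revert m; nat_ind.
- exists emp; split; [apply emp_in_omega|]; intros j Hj; destruct (in_emp Hj).
- intros m Hm [k [Hk IH]].
  destruct (Fin_minimal (Hfin Hm)
    (F := img (sep omega (fun l => enum k ⊆ enum l)) (fun l => diff (D m) (enum l))))
    as [V [HV Hmin]].
  + exists (diff (D m) (enum k)); rimg; exists k; split; [|reflexivity].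
    rsep; split; [exact Hk | intros x Hx; exact Hx].
  + intros V HV; rimg in HV; destruct HV as [l [_ ->]].
    intros x Hx; apply in_diff in Hx; apply Hx.
  + rimg in HV; destruct HV as [l [Hl ->]]; rsep in Hl; destruct Hl as [Hl Hkl].
    destruct (nonempty_or_emp (diff (D m) (enum l))) as [E|Hne].
    * exists l; split; [exact Hl|]; intros j Hj x Hx.
      apply in_succ in Hj; destruct Hj as [Hj| ->]; [apply Hkl, (IH j Hj x Hx)|].
      apply NNPP; intros Hx'; apply (@in_emp M HM x); rewrite <- E, in_diff; auto.
    * exfalso.
      assert (Hnot : ~ D m ⊆ enum l).
      { destruct Hne as [x Hx]; apply in_diff in Hx; intros K.
        apply (proj2 Hx), K, Hx. }
      destruct (@least_spec M HM (fun n => ~ D n ⊆ enum l)) as [H1 [H2 H3]];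
        [df | eauto |].
      assert (E : least (fun n => ~ D n ⊆ enum l) = m).
      { destruct (omega_trichotomy H1 Hm) as [H|[H|H]]; [|exact H|].
        - destruct H2; intros x Hx; apply Hkl, (IH _ H x Hx).
        - destruct (H3 m H Hnot). }
      assert (Hx : c (missing (enum l)) ∈ missing (enum l)).
      { apply (Hchoice (n := m)); [exact Hm| |]; unfold missing; rewrite E;
          [|exact Hne].
        intros x Hx; apply in_diff in Hx; apply Hx. }
      assert (Hx' : c (missing (enum l)) ∈ enum (succ l)).
      { rewrite enum_succ by exact Hl; apply in_cup; right.
        apply in_cap; rewrite in_sing; auto. }
      assert (K : diff (D m) (enum (succ l)) = diff (D m) (enum l)).
      { assert (S : enum l ⊆ enum (succ l))
          by (apply enum_mono; [apply succ_in_omega; exact Hl | apply in_succ; auto]).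
        apply Hmin.
        - rimg; exists (succ l); split; [|reflexivity]; rsep.
          split; [apply succ_in_omega; exact Hl|]; intros x Hxk; auto.
        - intros x; rewrite !in_diff; intros [A B]; auto. }
      unfold missing in Hx at 2; rewrite E, <- K, in_diff in Hx.
      apply Hx, Hx'.
Qed.

(** A countable union of finite sets is countable when one function chooses from
    the non-empty subsets of all of them. *)
Lemma countable_union_of_finite : countable U.
Proof.
(* [x] gets as index the step that adds it; a step adds at most one element. *)
set (idx := fun x => least (fun k => x ∈ enum (succ k))).
assert (Hidx : forall x, x ∈ U -> idx x ∈ omega /\ x ∈ enum (succ (idx x)) /\
  x ∉ enum (idx x)).
{ intros x Hx; apply HU in Hx; destruct Hx as [n [Hn Hx]].
  destruct (enum_covers (succ_in_omega Hn)) as [k [Hk K]].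
  destruct (@least_spec M HM (fun k => x ∈ enum (succ k))) as [H1 [H2 H3]].
  - df.
  - exists k; split; [exact Hk|].
    apply (enum_mono (succ_in_omega Hk) (k := k)); [apply in_succ; auto|].
    apply (K n); [apply in_succ; auto | exact Hx].
  - fold (idx x) in H1, H2, H3; split; [exact H1|]; split; [exact H2|].
    revert H1 H3; generalize (idx x); nat_ind.
    + intros _; rewrite enum_0; apply in_emp.
    + intros j Hj _ H; apply H, in_succ; auto. }
apply (@countable_of_inj M HM U idx).
- unfold idx; df.
- intros x Hx; apply Hidx, Hx.
- intros x y Hx Hy E.
  destruct (Hidx x Hx) as [H1 [H2 H3]]; destruct (Hidx y Hy) as [_ [K2 K3]].
  rewrite <- E in K2, K3; rewrite enum_succ in H2, K2 by exact H1.
  unfold enum_step in H2, K2; rewrite in_cup, in_cap, in_sing in H2, K2.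
  destruct H2 as [H2|[-> _]]; [contradiction|].
  destruct K2 as [K2|[-> _]]; [contradiction | reflexivity].
Qed.

End CountableUnion.

(** * Real numbers of the model *)

Section Reals.
Context {M : set_structure} {HM : models_ZF M}.
Context (R : real_structure M) (HR : is_real_field R).
Implicit Types a b c e x y z : M.

(** [add x y] is the sum, for [x] and [y] real; [half x] is the real [y] with
    [y + y = x]. *)
Definition add x y : M := app (radd R) (op x y).
Definition half x : M := iota (fun y => y ∈ rset R /\ add y y = x).

Lemma T2_add : T2 add.
Proof. unfold add; df. Qed.
#[local] Hint Resolve T2_add : defs.
Lemma T1_half : T1 half.
Proof. unfold half; df. Qed.
Lemma D2_Rle : D2 (@Rle M R).
Proof. unfold Rle; df. Qed.
#[local] Hint Resolve T1_half D2_Rle : defs.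
Lemma D2_Rlt : D2 (@Rlt M R).
Proof. unfold Rlt; df. Qed.
#[local] Hint Resolve D2_Rlt : defs.

Notation "x <=r y" := (Rle R x y) (at level 70).
Notation "x <r y" := (Rlt R x y) (at level 70).

Lemma function2_spec (f a b x y : M) : is_function2 f a b ->
  x ∈ a -> y ∈ a ->
  (forall z, rel2 f x y z <-> z = app f (op x y)) /\ app f (op x y) ∈ b.
Proof.
intros [c [Hc Hf]] Hx Hy.
assert (K : op x y ∈ c).
{ apply Hc; exists x, y; rewrite is_opair_eq; auto. }
destruct (app_spec Hf K) as [H1 H2]; split; [|exact H2].
intros z; rewrite rel2_op; apply H1.
Qed.

Lemma Radd_add x y : x ∈ rset R -> y ∈ rset R ->
  (forall z, Radd R x y z <-> z = add x y).
Proof. intros Hx Hy; apply (function2_spec (radd_fun HR) Hx Hy). Qed.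

Lemma add_in x y : x ∈ rset R -> y ∈ rset R -> add x y ∈ rset R.
Proof. intros Hx Hy; apply (function2_spec (radd_fun HR) Hx Hy). Qed.
#[local] Hint Resolve add_in : core.

Lemma Radd_intro x y : x ∈ rset R -> y ∈ rset R -> Radd R x y (add x y).
Proof. intros Hx Hy; apply Radd_add; auto. Qed.
#[local] Hint Resolve Radd_intro : core.

Lemma addC x y : x ∈ rset R -> y ∈ rset R -> add x y = add y x.
Proof. intros Hx Hy; apply Radd_add; auto; apply (radd_comm HR); auto. Qed.

Lemma addA x y z : x ∈ rset R -> y ∈ rset R -> z ∈ rset R ->
  add (add x y) z = add x (add y z).
Proof.
intros Hx Hy Hz; apply Radd_add; auto.
apply (radd_assoc HR (x := x) (y := y) (z := z) (a := add x y)); auto.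
Qed.

Lemma add0 x : x ∈ rset R -> add x (r0 R) = x.
Proof.
intros Hx; symmetry; apply Radd_add; [exact Hx | apply HR | apply (radd_0 HR Hx)].
Qed.

Lemma Rle_in x y : x <=r y -> x ∈ rset R /\ y ∈ rset R.
Proof.
intros [p [Hp Hr]]; destruct (rle_in HR Hr) as [u [v [Hu [Hv E]]]].
rewrite is_opair_eq in Hp, E; subst p; apply op_inj in E.
destruct E as [-> ->]; auto.
Qed.

Lemma Rlt_in x y : x <r y -> x ∈ rset R /\ y ∈ rset R.
Proof. intros [H _]; apply Rle_in, H. Qed.

Lemma le_lt_trans x y z : x <=r y -> y <r z -> x <r z.
Proof.
intros H [K N]; split; [exact (rle_trans HR H K)|].
intros ->; apply N, (rle_antisym HR); assumption.
Qed.

Lemma lt_le_trans x y z : x <r y -> y <=r z -> x <r z.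
Proof.
intros [H N] K; split; [exact (rle_trans HR H K)|].
intros ->; apply N, (rle_antisym HR); assumption.
Qed.

Lemma lt_irrefl x : ~ x <r x.
Proof. intros [_ N]; apply N; reflexivity. Qed.

Lemma le_or_lt x y : x ∈ rset R -> y ∈ rset R -> x <=r y \/ y <r x.
Proof.
intros Hx Hy; destruct (classic (y = x)) as [-> |N].
- left; apply (rle_refl HR Hx).
- destruct (rle_total HR Hx Hy); [auto | right; split; auto].
Qed.

Lemma le_add x y z : x <=r y -> z ∈ rset R -> add x z <=r add y z.
Proof.
intros H Hz; destruct (Rle_in H) as [Hx Hy].
apply (rle_add HR (x := x) (y := y) (z := z)); auto.
Qed.

Lemma le_add2 a b c e : a <=r b -> c <=r e -> add a c <=r add b e.
Proof.
intros H K; destruct (Rle_in H); destruct (Rle_in K).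
apply (rle_trans HR (y := add b c)); [apply le_add; auto|].
rewrite (addC (x := b) (y := c)), (addC (x := b) (y := e)) by auto.
apply le_add; auto.
Qed.

Lemma add_cancel x y z : x ∈ rset R -> y ∈ rset R -> z ∈ rset R ->
  add x z = add y z -> x = y.
Proof.
intros Hx Hy Hz E; destruct (radd_opp HR Hz) as [o [Ho K]].
rewrite Radd_add in K by auto.
rewrite <- (add0 Hx), <- (add0 Hy), K, <- !addA, E by auto; reflexivity.
Qed.

Lemma lt_add x y z : x <r y -> z ∈ rset R -> add x z <r add y z.
Proof.
intros [H N] Hz; destruct (Rle_in H); split; [apply le_add; auto|].
intros E; apply N, (add_cancel (z := z)); auto.
Qed.

Lemma lt_add2 a b c e : a <r b -> c <r e -> add a c <r add b e.
Proof.
intros H [K _]; destruct (Rlt_in H); destruct (Rle_in K).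
apply (lt_le_trans (y := add b c)); [apply lt_add; auto|].
apply le_add2; [apply (rle_refl HR) | ]; auto.
Qed.

(* If [1 + 1 = 0], then adding 1 to [0 <= 1] gives [1 <= 0], and conversely, so
   that [0 = 1] in both cases. *)
Lemma two_neq0 : add (r1 R) (r1 R) <> r0 R.
Proof.
pose proof (r0_in HR) as H0; pose proof (r1_in HR) as H1; intros E.
destruct (rle_total HR H0 H1) as [H|H].
- pose proof (le_add H H1) as K; rewrite E, addC, add0 in K by auto.
  apply (r1_neq_r0 HR), (rle_antisym HR); assumption.
- pose proof (le_add H H1) as K; rewrite E, addC, add0 in K by auto.
  apply (r1_neq_r0 HR), (rle_antisym HR); assumption.
Qed.

Lemma half_exists x : x ∈ rset R -> exists y, y ∈ rset R /\ add y y = x.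
Proof.
intros Hx; pose proof (r1_in HR) as H1.
destruct (rmul_inv HR (x := add (r1 R) (r1 R))) as [t [Ht E]];
  [auto | apply two_neq0 |].
(* [t] is the inverse of 2, so [t + t = 1] and [x = x * t + x * t]. *)
assert (Et : Radd R t t (r1 R)).
{ apply (rmul_add HR (x := t) (y := r1 R) (z := r1 R)
    (a := add (r1 R) (r1 R))); auto.
  - apply (rmul_comm HR), E.
  - apply (rmul_1 HR Ht).
  - apply (rmul_1 HR Ht). }
destruct (function2_spec (rmul_fun HR) Hx Ht) as [K Hy].
exists (app (rmul R) (op x t)); split; [exact Hy|].
symmetry; apply Radd_add; [exact Hy | exact Hy |].
apply (rmul_add HR (x := x) (y := t) (z := t) (a := r1 R)); auto.
- apply (rmul_1 HR Hx).
- apply K; reflexivity.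
- apply K; reflexivity.
Qed.

Lemma double_lt x y : x <r y -> add x x <r add y y.
Proof. intros H; apply lt_add2; exact H. Qed.

Lemma double_le x y : x ∈ rset R -> y ∈ rset R ->
  add x x <=r add y y -> x <=r y.
Proof.
intros Hx Hy H; destruct (le_or_lt Hx Hy) as [K|K]; [exact K|].
apply double_lt in K; destruct (lt_irrefl (lt_le_trans K H)).
Qed.

Lemma half_spec x : x ∈ rset R -> half x ∈ rset R /\ add (half x) (half x) = x.
Proof.
intros Hx; unfold half.
apply (@iota_spec M HM (fun y => y ∈ rset R /\ add y y = x)).
destruct (half_exists Hx) as [y [Hy E]]; exists y; split; [auto|].
intros z [Hz E']; apply (rle_antisym HR); apply double_le; auto;
  rewrite E, E'; apply (rle_refl HR Hx).
Qed.

Lemma half_pos x : r0 R <r x -> r0 R <r half x.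
Proof.
intros H; destruct (Rlt_in H) as [H0 Hx]; destruct (half_spec Hx) as [Hh E].
destruct (le_or_lt Hh H0) as [K|K]; [|exact K]; exfalso.
pose proof (le_add2 K K) as L; rewrite E, add0 in L by auto.
exact (lt_irrefl (lt_le_trans H L)).
Qed.

Lemma half_le x : r0 R <r x -> half x <=r x.
Proof.
intros H; destruct (Rlt_in H) as [H0 Hx]; destruct (half_spec Hx) as [Hh E].
rewrite <- E at 2; rewrite <- (add0 Hh) at 1.
apply le_add2; [apply (rle_refl HR Hh) | apply half_pos, H].
Qed.

(* Either 1 or its opposite is positive; which one does not matter. *)
Lemma exists_pos : exists p, r0 R <r p.
Proof.
pose proof (r0_in HR) as H0; pose proof (r1_in HR) as H1.
destruct (le_or_lt H1 H0) as [H|H]; [|eauto].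
destruct (radd_opp HR H1) as [o [Ho E]]; rewrite Radd_add in E by auto.
exists o; split.
- pose proof (le_add H Ho) as K; rewrite <- E, addC, add0 in K by auto; exact K.
- intros <-; apply (r1_neq_r0 HR); rewrite add0 in E by auto; auto.
Qed.

(** A decreasing sequence of positive reals tending to 0: halve repeatedly. If
    [s] is the supremum of the lower bounds of the sequence, so is [s + s]. *)
Lemma small_sequence : exists h : M -> M, T1 h /\
  (forall n, n ∈ omega -> r0 R <r h n) /\
  (forall n, n ∈ omega -> forall m, m ∈ n \/ m = n -> h n <=r h m) /\
  (forall e, r0 R <r e -> exists n, n ∈ omega /\ h n <r e).
Proof.
destruct exists_pos as [p Hp]; pose proof (r0_in HR) as H0.
set (h := rec (fun _ => p) (fun _ _ x => half x) emp).
assert (Hh : T1 h) by (unfold h; df).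
assert (E0 : h emp = p) by exact (rec_0 (fun _ => p) (fun _ _ x => half x) emp).
assert (ES : forall n, n ∈ omega -> h (succ n) = half (h n)).
{ intros n; apply (@rec_succ M HM (fun _ => p) (fun _ _ x => half x)); df. }
assert (Hpos : forall n, n ∈ omega -> r0 R <r h n).
{ nat_ind; [rewrite E0; exact Hp|].
  intros n Hn IH; rewrite ES by exact Hn; apply half_pos, IH. }
exists h; split; [exact Hh|]; split; [exact Hpos|]; split.
- nat_ind.
  + intros m [Hm| ->]; [destruct (in_emp Hm)|]; apply (rle_refl HR).
    apply (Rlt_in (Hpos _ (emp_in_omega))).
  + intros n Hn IH m [Hm| ->].
    * rewrite ES by exact Hn; apply in_succ in Hm.
      apply (rle_trans HR (y := h n)); [apply half_le; auto | auto].
    * apply (rle_refl HR); apply (Rlt_in (Hpos _ (succ_in_omega Hn))).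
- intros e He; apply NNPP; intros Hno.
  assert (Hlow : forall n, n ∈ omega -> e <=r h n).
  { intros n Hn; destruct (Rlt_in He) as [_ He'].
    destruct (Rlt_in (Hpos n Hn)) as [_ Hn'].
    destruct (le_or_lt He' Hn') as [K|K]; [exact K|]; destruct Hno; eauto. }
  set (L := sep (rset R) (fun l => forall n, n ∈ omega -> l <=r h n)).
  assert (HL : forall l, l ∈ L <->
    l ∈ rset R /\ forall n, n ∈ omega -> l <=r h n)
    by (intros l; unfold L; rsep; reflexivity).
  destruct (r_complete HR (S := L)) as [s [[Hs Hub] Hleast]].
  + intros l Hl; apply HL in Hl; apply Hl.
  + exists e; apply HL; split; [apply (Rlt_in He) | exact Hlow].
  + exists (h emp); split; [apply (Rlt_in (Hpos _ emp_in_omega))|].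
    intros l Hl; apply HL in Hl; apply Hl, emp_in_omega.
  + assert (Hsl : forall n, n ∈ omega -> s <=r h n).
    { intros n Hn; apply Hleast; split; [apply (Rlt_in (Hpos n Hn))|].
      intros l Hl; apply HL in Hl; apply Hl, Hn. }
    assert (Hes : e <=r s) by (apply Hub, HL; split; [apply (Rlt_in He) | exact Hlow]).
    assert (Hss : add s s <=r s).
    { apply Hub, HL; split; [auto|]; intros n Hn.
      assert (K : h n ∈ rset R) by apply (Rlt_in (Hpos n Hn)).
      rewrite <- (proj2 (half_spec K)), <- ES by exact Hn.
      apply le_add2; apply Hsl, succ_in_omega, Hn. }
    pose proof (lt_le_trans He Hes) as Hs0.
    pose proof (lt_add Hs0 Hs) as K; rewrite addC, add0 in K by auto.
    exact (lt_irrefl (lt_le_trans K Hss)).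
Qed.

End Reals.

#[export] Hint Resolve T2_add T1_half D2_Rle D2_Rlt : defs.

(** * Metric spaces of the model *)

Section Metric.
Context {M : set_structure} {HM : models_ZF M}.
Context (R : real_structure M) (HR : is_real_field R).
Context (X d T : M) (Hd : is_metric R X d) (HT : metric_topology R X d T).

Notation "x <=r y" := (Rle R x y) (at level 70).
Notation "x <r y" := (Rlt R x y) (at level 70).

(** The distance as an operation, meaningful for [x] and [y] in [X], and the open
    balls. *)
Definition dist x y : M := app d (op x y).
Definition ball x r : M := sep X (fun y => dist x y <r r).

(** The closure in the whole space. *)
Definition cl (E : M) : M :=
  sep X (fun y => forall r, r0 R <r r -> exists z, z ∈ E /\ dist y z <r r).

Lemma T2_dist : T2 dist.
Proof. unfold dist; df. Qed.
#[local] Hint Resolve T2_dist : defs.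
Lemma T2_ball : T2 ball.
Proof. unfold ball; df. Qed.
Lemma T1_cl : T1 cl.
Proof. unfold cl; df. Qed.
#[local] Hint Resolve T2_ball T1_cl : defs.

Lemma rel2_dist x y r : x ∈ X -> y ∈ X -> (rel2 d x y r <-> r = dist x y).
Proof. intros Hx Hy; exact (proj1 (function2_spec (metric_fun Hd) Hx Hy) r). Qed.

Lemma dist_in x y : x ∈ X -> y ∈ X -> dist x y ∈ rset R.
Proof. intros Hx Hy; exact (proj2 (function2_spec (metric_fun Hd) Hx Hy)). Qed.

Lemma dist_ge0 x y : x ∈ X -> y ∈ X -> r0 R <=r dist x y.
Proof.
intros Hx Hy; apply (metric_ge0 Hd (x := x) (y := y)), rel2_dist; auto.
Qed.

Lemma dist_eq0 x y : x ∈ X -> y ∈ X -> (r0 R = dist x y <-> x = y).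
Proof. intros Hx Hy; rewrite <- (metric_eq0 Hd Hx Hy), rel2_dist; tauto. Qed.

Lemma dist_sym x y : x ∈ X -> y ∈ X -> dist x y = dist y x.
Proof.
intros Hx Hy; apply rel2_dist; auto; apply (metric_sym Hd), rel2_dist; auto.
Qed.

Lemma dist_triangle x y z : x ∈ X -> y ∈ X -> z ∈ X ->
  dist x z <=r add R (dist x y) (dist y z).
Proof.
intros Hx Hy Hz.
apply (metric_triangle Hd (x := x) (y := y) (z := z)
  (b := dist x y) (c := dist y z)); try (apply rel2_dist; auto).
apply (Radd_intro HR); apply dist_in; auto.
Qed.

Lemma dist_lt_half x y z r : x ∈ X -> y ∈ X -> z ∈ X -> r ∈ rset R ->
  dist x y <r half R r -> dist y z <r half R r -> dist x z <r r.
Proof.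
intros Hx Hy Hz Hr H1 H2.
apply (le_lt_trans HR (dist_triangle Hx Hy Hz)).
rewrite <- (proj2 (half_spec HR Hr)); apply (lt_add2 HR H1 H2).
Qed.

Lemma in_ball x r y : y ∈ ball x r <-> y ∈ X /\ dist x y <r r.
Proof. unfold ball; rsep; reflexivity. Qed.

Lemma ball_center x r : x ∈ X -> r0 R <r r -> x ∈ ball x r.
Proof.
intros Hx Hr; apply in_ball; split; [exact Hx|].
rewrite <- (proj2 (dist_eq0 Hx Hx) eq_refl); exact Hr.
Qed.

Lemma openE U : U ∈ T <->
  U ⊆ X /\ forall x, x ∈ U -> exists r, r0 R <r r /\ ball x r ⊆ U.
Proof.
rewrite (HT U); split; intros [HU H]; (split; [exact HU|]); intros x Hx;
  destruct (H x Hx) as [r Hr].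
- destruct Hr as [_ [Hr K]]; exists r; split; [exact Hr|].
  intros y Hy; apply in_ball in Hy; destruct Hy as [Hy L].
  apply (K y (dist x y)); [exact Hy | apply rel2_dist; auto | exact L].
- destruct Hr as [Hr K]; exists r; split; [apply (Rlt_in HR Hr)|].
  split; [exact Hr|]; intros y s Hy Hs L; apply K, in_ball.
  rewrite rel2_dist in Hs by auto; subst s; auto.
Qed.

Lemma ball_open x r : x ∈ X -> ball x r ∈ T.
Proof.
intros Hx; apply openE; split; [intros y Hy; apply in_ball in Hy; apply Hy|].
intros y Hy; apply in_ball in Hy; destruct Hy as [Hy L].
pose proof (dist_in Hx Hy) as Kd; destruct (Rlt_in HR L) as [_ Kr].
destruct (radd_opp HR Kd) as [o [Ho E]].
rewrite (Radd_add HR) in E by auto.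
(* The radius is [r - dist x y]. *)
exists (add R r o); split.
- rewrite E; apply (lt_add HR L Ho).
- intros z Hz; apply in_ball in Hz; destruct Hz as [Hz Lz]; apply in_ball.
  split; [exact Hz|]; apply (le_lt_trans HR (dist_triangle Hx Hy Hz)).
  pose proof (lt_add HR Lz Kd) as K.
  rewrite (addA HR), (addC HR Ho Kd), <- E, (add0 HR) in K by auto.
  rewrite (addC HR (dist_in Hy Hz) Kd) in K; exact K.
Qed.

Lemma cap_open U V : U ∈ T -> V ∈ T -> cap U V ∈ T.
Proof.
rewrite !openE; intros [HU KU] [HV KV]; split.
- intros x Hx; apply in_cap in Hx; apply HU, Hx.
- intros x Hx; apply in_cap in Hx; destruct Hx as [HxU HxV].
  destruct (KU x HxU) as [r [Hr Lr]]; destruct (KV x HxV) as [s [Hs Ls]].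
  destruct (Rlt_in HR Hr) as [_ Kr]; destruct (Rlt_in HR Hs) as [_ Ks].
  destruct (le_or_lt HR Kr Ks) as [L|L].
  + exists r; split; [exact Hr|]; intros y Hy; apply in_cap; split; [auto|].
    apply in_ball in Hy; apply Ls, in_ball; split; [apply Hy|].
    apply (lt_le_trans HR (proj2 Hy) L).
  + exists s; split; [exact Hs|]; intros y Hy; apply in_cap; split; [|auto].
    apply in_ball in Hy; apply Lr, in_ball; split; [apply Hy|].
    apply (lt_le_trans HR (proj2 Hy) (proj1 L)).
Qed.

Lemma in_cl E y : y ∈ cl E <->
  y ∈ X /\ forall r, r0 R <r r -> exists z, z ∈ E /\ dist y z <r r.
Proof. unfold cl; rsep; reflexivity. Qed.

Lemma cl_in_X E : cl E ⊆ X.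
Proof. intros x Hx; apply in_cl in Hx; apply Hx. Qed.

Lemma subset_cl E : E ⊆ X -> E ⊆ cl E.
Proof.
intros HE x Hx; apply in_cl; split; [auto|]; intros r Hr; exists x.
split; [exact Hx|]; apply (in_ball x r x), ball_center; auto.
Qed.

Lemma cl_mono E F : E ⊆ F -> cl E ⊆ cl F.
Proof.
intros HEF x; rewrite !in_cl; intros [Hx H]; split; [exact Hx|].
intros r Hr; destruct (H r Hr) as [z [Hz L]]; exists z; auto.
Qed.

Lemma cl_cl E : E ⊆ X -> cl (cl E) ⊆ cl E.
Proof.
intros HE x; rewrite !in_cl; intros [Hx H]; split; [exact Hx|]; intros r Hr.
pose proof (half_pos HR Hr) as Hr2.
destruct (H _ Hr2) as [y [Hy L]]; apply in_cl in Hy; destruct Hy as [Hy K].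
destruct (K _ Hr2) as [z [Hz L']]; exists z; split; [exact Hz|].
apply (dist_lt_half (y := y)); auto; apply (Rlt_in HR Hr).
Qed.

(** A point of the closure of [E] with a neighbourhood [U] sees [E] inside [U]. *)
Lemma cl_meets_open E U x : E ⊆ X -> U ∈ T -> x ∈ U -> x ∈ cl E ->
  exists z, z ∈ U /\ z ∈ E.
Proof.
intros HE HU Hx Hcl; apply openE in HU; destruct HU as [HU K].
destruct (K x Hx) as [r [Hr L]]; apply in_cl in Hcl.
destruct (proj2 Hcl r Hr) as [z [Hz Lz]]; exists z; split; [|exact Hz].
apply L, in_ball; auto.
Qed.

(** [C] is closed in the subspace [A]: it contains its limit points in [A]. *)
Definition relclosed (A C : M) : Prop :=
  C ⊆ A /\ forall y, y ∈ A -> y ∈ cl C -> y ∈ C.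

Lemma D2_relclosed : D2 relclosed.
Proof. unfold relclosed; df. Qed.

Lemma relclosedE A S C : A ⊆ X -> subspace_topology T A S ->
  (closed_in A S C <-> relclosed A C).
Proof.
intros HA HS; split.
- intros [HC [V [HV KV]]]; split; [exact HC|]; intros y Hy Hcl.
  apply HS in KV; destruct KV as [U [HU E]].
  apply NNPP; intros Hn.
  assert (HyU : y ∈ U) by (apply E, HV; auto).
  destruct (cl_meets_open (E := C) (U := U) (x := y)) as [z [Hz Hz']]; auto.
  { intros u Hu; auto. }
  assert (K : z ∈ V) by (apply E; auto).
  apply HV in K; apply K, Hz'.
- intros [HC K]; split; [exact HC|]; exists (diff A C); split.
  { intros x; apply in_diff. }
  apply HS; exists (diff X (cl C)); split.
  + apply openE; split; [intros x Hx; apply in_diff in Hx; apply Hx|].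
    intros x Hx; apply in_diff in Hx; destruct Hx as [Hx Hn].
    apply NNPP; intros Hno; apply Hn, in_cl; split; [exact Hx|].
    intros r Hr; apply NNPP; intros Hno'; apply Hno; exists (half R r).
    split; [apply (half_pos HR Hr)|].
    intros y Hy; apply in_ball in Hy; destruct Hy as [Hy L]; apply in_diff.
    split; [exact Hy|]; intros Hcl; apply in_cl in Hcl.
    destruct (proj2 Hcl _ (half_pos HR Hr)) as [z [Hz Lz]].
    apply Hno'; exists z; split; [exact Hz|].
    apply (dist_lt_half (y := y)); auto; apply (Rlt_in HR Hr).
  + intros x; rewrite !in_diff; split; [intros [Hx Hn]|intros [[_ Hn] Hx]].
    * split; [split; [auto | intros Hcl; auto] | exact Hx].
    * split; [exact Hx|]; intros HxC; apply Hn, subset_cl; [|exact HxC].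
      intros u Hu; auto.
Qed.

Lemma subspace_whole : subspace_topology T X T.
Proof.
assert (K : forall U, U ∈ T -> forall x, x ∈ U <-> x ∈ U /\ x ∈ X).
{ intros U HU x; split; [|tauto]; intros Hx; split; [exact Hx|].
  apply openE in HU; apply HU, Hx. }
intros V; split.
- intros HV; exists V; split; [exact HV | exact (K V HV)].
- intros [U [HU E]]; replace V with U; [exact HU|]; apply ext_eq.
  intros x; rewrite (E x); apply (K U HU).
Qed.

Lemma relclosed_cl E : E ⊆ X -> relclosed X (cl E).
Proof.
intros HE; split; [apply cl_in_X|]; intros y _; apply cl_cl, HE.
Qed.

Lemma relclosed_cl_cap A E : A ⊆ X -> E ⊆ X -> relclosed A (cap (cl E) A).
Proof.
intros HA HE; split; [intros x Hx; apply in_cap in Hx; apply Hx|].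
intros y Hy Hcl; apply in_cap; split; [|exact Hy].
apply (cl_cl HE); revert Hcl; apply cl_mono; intros x Hx.
apply in_cap in Hx; apply Hx.
Qed.

Lemma relclosed_Fin A a : A ⊆ X -> Fin a -> a ⊆ A -> relclosed A a.
Proof.
intros HA Ha HaA; split; [exact HaA|]; intros y Hy Hcl.
apply NNPP; intros Hn.
assert (K : exists r, r0 R <r r /\ forall x, x ∈ a -> r <=r dist y x).
{ apply (Ha (fun a => exists r, r0 R <r r /\ forall x, x ∈ a -> r <=r dist y x)).
  - df.
  - destruct (exists_pos HR) as [p Hp]; exists p; split; [exact Hp|].
    intros x Hx; destruct (in_emp Hx).
  - intros Z x _ Hx [r [Hr L]].
    assert (Hyx : dist y x ∈ rset R) by (apply dist_in; auto).
    destruct (le_or_lt HR (proj2 (Rlt_in HR Hr)) Hyx) as [K|K].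
    + exists r; split; [exact Hr|]; intros z Hz; apply in_cup in Hz.
      rewrite in_sing in Hz; destruct Hz as [Hz| ->]; [apply L, Hz | exact K].
    + exists (dist y x); split.
      * split; [apply dist_ge0; auto|].
        rewrite dist_eq0 by auto; intros ->; auto.
      * intros z Hz; apply in_cup in Hz.
        rewrite in_sing in Hz; destruct Hz as [Hz| ->].
        -- apply (rle_trans HR (y := r)); [apply K | auto].
        -- apply (rle_refl HR Hyx). }
destruct K as [r [Hr L]]; apply in_cl in Hcl.
destruct (proj2 Hcl r Hr) as [z [Hz Lz]].
exact (lt_irrefl (le_lt_trans HR (L z Hz) Lz)).
Qed.

Lemma base_open B W : open_base T B -> W ∈ B -> W ⊆ X.
Proof. intros [HB _] HW; apply HB, openE in HW; apply HW. Qed.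

Lemma base_refines B U x : open_base T B -> U ∈ T -> x ∈ U ->
  exists W, W ∈ B /\ x ∈ W /\ W ⊆ U.
Proof.
intros [HB H] HU Hx; destruct (H U HU) as [F [HF E]].
pose proof Hx as Hx'; apply E in Hx'; destruct Hx' as [W [HW HxW]].
exists W; split; [auto|]; split; [exact HxW|].
intros y Hy; apply E; eauto.
Qed.

(** Metric spaces are regular. *)
Lemma base_regular B x r : open_base T B -> x ∈ X -> r0 R <r r ->
  exists W, W ∈ B /\ x ∈ W /\ cl W ⊆ ball x r.
Proof.
intros HB Hx Hr; pose proof (half_pos HR Hr) as Hr2.
destruct (base_refines HB (ball_open (half R r) Hx) (ball_center Hx Hr2))
  as [W [HW [HxW HWU]]].
exists W; split; [exact HW|]; split; [exact HxW|].
intros y Hy; pose proof (cl_in_X Hy) as HyX; apply in_ball; split; [exact HyX|].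
apply in_cl in Hy; destruct (proj2 Hy _ Hr2) as [z [Hz L]].
apply HWU, in_ball in Hz; destruct Hz as [Hz L'].
apply (dist_lt_half Hx Hz HyX (proj2 (Rlt_in HR Hr)) L').
rewrite (dist_sym Hz HyX); exact L.
Qed.

End Metric.

#[export] Hint Resolve T2_dist T2_ball T1_cl D2_relclosed : defs.

(** * Choosing points of closed subsets of a G-delta set *)

Section GDeltaChoice.
Context {M : set_structure} {HM : models_ZF M}.
Context (R : real_structure M) (HR : is_real_field R).
Context (X d T : M) (Hd : is_metric R X d) (HT : metric_topology R X d T).
Hypothesis Hcomplete : cantor_complete R X d.
Variables (B : M) (sel : M -> M).
Hypotheses (HB : open_base T B) (Hsel : T1 sel).
Hypothesis sel_in : forall Z, Z ⊆ B -> nonempty Z -> sel Z ∈ Z.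
Variables (A G : M) (idx : M -> M).
Hypotheses (HG : G ⊆ T) (Hidx : T1 idx).
Hypothesis idx_in : forall U, U ∈ G -> idx U ∈ omega.
Hypothesis idx_inj : forall U V, U ∈ G -> V ∈ G -> idx U = idx V -> U = V.
Hypothesis HA : forall x, x ∈ A <-> x ∈ X /\ forall U, U ∈ G -> x ∈ U.
Variable h : M -> M.
Hypotheses (Hh : T1 h)
  (h_pos : forall n, n ∈ omega -> Rlt R (r0 R) (h n))
  (h_dec : forall n, n ∈ omega ->
     forall m, m ∈ n \/ m = n -> Rle R (h n) (h m))
  (h_lim : forall e, Rlt R (r0 R) e -> exists n, n ∈ omega /\ Rlt R (h n) e).

Notation dist := (dist d).
Notation ball := (ball R X d).
Notation cl := (cl R X d).

(** The basic open set [W] meets [C], and its closure has diameter at most [h n]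
    and lies inside [V] and inside the member of [G] of index [n], if any. *)
Definition good (C n V W : M) : Prop :=
  (exists x, x ∈ W /\ x ∈ C) /\ cl W ⊆ V /\
  (forall U, U ∈ G -> idx U = n -> cl W ⊆ U) /\
  forall x y, x ∈ cl W -> y ∈ cl W -> Rle R (dist x y) (h n).

(** The sequence of neighbourhoods chosen for [C]; the term of index 0 is [X]. *)
Definition nbhd (C n : M) : M :=
  rec (fun _ => X) (fun C n V => sel (sep B (fun W => good C n V W))) C n.

(** The unique point in the intersection of the closures of the traces on [C] of
    the neighbourhoods. *)
Definition limit_point (C : M) : M :=
  iota (fun x => forall n, n ∈ omega -> x ∈ cl (cap (nbhd C (succ n)) C)).

Lemma T2_nbhd : T2 nbhd.
Proof. unfold nbhd, good; df. Qed.
#[local] Hint Resolve T2_nbhd : defs.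

Lemma T1_limit_point : T1 limit_point.
Proof. unfold limit_point; df. Qed.

Variable C : M.
Hypotheses (HC : relclosed R X d A C) (HCne : nonempty C).

Lemma C_in_X : C ⊆ X.
Proof. intros x Hx; exact (proj1 (proj1 (HA x) (proj1 HC x Hx))). Qed.

(* Around a point of [C] in [V] there is a ball inside [V] and the [n]-th member of
   [G]; by regularity a basic set has its closure in a ball of radius at most half
   of [h n] inside it. *)
Lemma good_exists n V x : n ∈ omega -> V ∈ T -> x ∈ V -> x ∈ C ->
  exists W, W ∈ B /\ good C n V W.
Proof.
intros Hn HV HxV HxC; pose proof (C_in_X HxC) as HxX.
assert (HV' : exists V', V' ∈ T /\ x ∈ V' /\ V' ⊆ V /\
  forall U, U ∈ G -> idx U = n -> V' ⊆ U).
{ destruct (classic (exists U, U ∈ G /\ idx U = n)) as [[U [HU E]]|Hno].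
  - exists (cap V U); split; [apply (cap_open HR Hd HT HV (HG HU))|]; split; [|split].
    + apply in_cap; split; [exact HxV|].
      exact (proj2 (proj1 (HA x) (proj1 HC x HxC)) U HU).
    + intros y Hy; apply in_cap in Hy; apply Hy.
    + intros U' HU' E' y Hy; apply in_cap in Hy.
      replace U' with U; [apply Hy | apply idx_inj; congruence].
  - exists V; split; [exact HV|]; split; [exact HxV|]; split.
    + intros y Hy; exact Hy.
    + intros U HU E; destruct Hno; eauto. }
destruct HV' as [V' [HV' [HxV' [HVV' HVG]]]].
pose proof (proj1 (openE HR Hd HT V') HV') as [_ K].
destruct (K x HxV') as [r [Hr L]].
pose proof (half_pos HR (h_pos Hn)) as Hs.
destruct (half_spec HR (proj2 (Rlt_in HR (h_pos Hn)))) as [Hs' Es].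
assert (Ht : exists t, Rlt R (r0 R) t /\ Rle R t r /\ Rle R t (half R (h n))).
{ destruct (Rlt_in HR Hr) as [_ Hr'].
  destruct (le_or_lt HR Hr' Hs') as [Q|[Q _]].
  - exists r; split; [exact Hr|]; split; [apply (rle_refl HR Hr') | exact Q].
  - exists (half R (h n)); split; [exact Hs|]; split; [exact Q|].
    apply (rle_refl HR Hs'). }
destruct Ht as [t [Ht [Htr Hth]]].
destruct (base_regular HR Hd HT HB HxX Ht) as [W [HW [HxW HWt]]].
assert (HWV : cl W ⊆ V').
{ intros y Hy; apply L, in_ball; apply HWt, in_ball in Hy.
  split; [apply Hy | apply (lt_le_trans HR (proj2 Hy) Htr)]. }
exists W; split; [exact HW|]; split; [eauto|]; split; [|split].
- intros y Hy; auto.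
- intros U HU E y Hy; apply (HVG U HU E); auto.
- intros y z Hy Hz; apply HWt, in_ball in Hy; apply HWt, in_ball in Hz.
  destruct Hy as [Hy Ly]; destruct Hz as [Hz Lz].
  apply (rle_trans HR (dist_triangle HR Hd Hy HxX Hz)).
  rewrite (dist_sym Hd Hy HxX), <- Es.
  apply (le_add2 HR); [apply (rle_trans HR (proj1 Ly) Hth) |].
  apply (rle_trans HR (proj1 Lz) Hth).
Qed.

Lemma nbhd_0 : nbhd C emp = X.
Proof.
exact (rec_0 (fun _ => X)
  (fun C n V => sel (sep B (fun W => good C n V W))) C).
Qed.

Lemma nbhd_good n : n ∈ omega -> nbhd C n ∈ T -> 
  (exists x, x ∈ nbhd C n /\ x ∈ C) ->
  nbhd C (succ n) ∈ B /\ good C n (nbhd C n) (nbhd C (succ n)).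
Proof.
intros Hn HV [x [Hx HxC]].
assert (E : nbhd C (succ n) = sel (sep B (fun W => good C n (nbhd C n) W))).
{ apply (@rec_succ M HM (fun _ => X)
    (fun C n V => sel (sep B (fun W => good C n V W)))); [|exact Hn].
  unfold good; df. }
assert (Hd' : D1 (fun W => good C n (nbhd C n) W)) by (unfold good; df).
rewrite E; apply (in_sep _ _ Hd'); apply sel_in.
- intros W HW; exact (proj1 (proj1 (in_sep _ _ Hd') HW)).
- destruct (good_exists Hn HV Hx HxC) as [W HW]; exists W.
  apply (in_sep _ _ Hd'), HW.
Qed.

Lemma nbhd_open n : n ∈ omega ->
  nbhd C n ∈ T /\ exists x, x ∈ nbhd C n /\ x ∈ C.
Proof.
revert n; nat_ind.
- rewrite nbhd_0; split.
  + apply (openE HR Hd HT); split; [intros x Hx; exact Hx|].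
    intros x Hx; destruct (exists_pos HR) as [p Hp]; exists p.
    split; [exact Hp|]; intros y Hy; apply in_ball in Hy; apply Hy.
  + destruct HCne as [x Hx]; exists x; split; [apply C_in_X|]; exact Hx.
- intros n Hn [H1 H2]; destruct (nbhd_good Hn H1 H2) as [HW [H _]].
  split; [apply HB, HW | exact H].
Qed.

Lemma nbhd_spec n : n ∈ omega ->
  nbhd C (succ n) ∈ B /\ good C n (nbhd C n) (nbhd C (succ n)).
Proof. intros Hn; apply nbhd_good; [exact Hn | apply nbhd_open, Hn ..]. Qed.

Notation trace n := (cl (cap (nbhd C (succ n)) C)).

Lemma cap_C_in_X V : cap V C ⊆ X.
Proof. intros x Hx; apply in_cap in Hx; apply C_in_X, Hx. Qed.

Lemma trace_in n x : x ∈ trace n -> x ∈ cl (nbhd C (succ n)).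
Proof. apply cl_mono; intros y Hy; apply in_cap in Hy; apply Hy. Qed.

Lemma trace_decreasing n : n ∈ omega -> trace (succ n) ⊆ trace n.
Proof.
intros Hn; apply cl_mono; intros x; rewrite !in_cap; intros [Hx HxC].
split; [|exact HxC].
destruct (nbhd_spec (succ_in_omega Hn)) as [HW [_ [K _]]].
apply K, (subset_cl Hd); [apply (base_open HR Hd HT HB HW) | exact Hx].
Qed.

Lemma trace_diameter n : n ∈ omega -> exists s,
  is_diameter R d (trace n) s /\ Rle R s (h n).
Proof.
intros Hn; destruct (nbhd_spec Hn) as [HW [[x [Hx HxC]] [_ [_ Hdiam]]]].
set (Q := sep (rset R) (fun r => exists x y,
  x ∈ trace n /\ y ∈ trace n /\ r = dist x y)).
assert (HQ : forall r, r ∈ Q <-> exists x y,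
  x ∈ trace n /\ y ∈ trace n /\ r = dist x y).
{ intros r; unfold Q; rsep; split; [tauto|]; intros H; split; [|exact H].
  destruct H as [u [v [Hu [Hv ->]]]]; apply (dist_in Hd);
    [apply (cl_in_X Hu) | apply (cl_in_X Hv)]. }
assert (Hub : upper_bound R Q (h n)).
{ split; [apply (Rlt_in HR (h_pos Hn))|]; intros r Hr; apply HQ in Hr.
  destruct Hr as [u [v [Hu [Hv ->]]]]; apply Hdiam; apply trace_in; assumption. }
destruct (r_complete HR (S := Q)) as [s Hs].
- intros r Hr; unfold Q in Hr; rsep in Hr; apply Hr.
- assert (K : x ∈ trace n).
  { apply (subset_cl Hd); [apply cap_C_in_X | apply in_cap; auto]. }
  exists (dist x x); apply HQ; eauto.
- eauto.
- exists s; split; [|apply Hs, Hub]; exists Q; split; [|exact Hs].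
  intros r; rewrite HQ; split; intros [u [v [Hu [Hv E]]]]; exists u, v;
    (split; [exact Hu|]; split; [exact Hv|]);
    apply (rel2_dist Hd r (cl_in_X Hu) (cl_in_X Hv)); exact E.
Qed.

Lemma trace_inter : exists x, forall n, n ∈ omega -> x ∈ trace n.
Proof.
assert (Ht : T1 (fun n => trace n)) by df.
destruct (Hcomplete (T := T) (w := omega)
  (F := lam omega (fun n => trace n)) (K := img omega (fun n => trace n)))
  as [x Hx].
- exact HT.
- apply omega_is_omega.
- apply lam_function; [exact Ht|]; intros n Hn; rimg; eauto.
- intros n D Hn HD; rewrite rel_lam in HD by exact Ht; destruct HD as [_ ->].
  split.
  + apply (relclosedE HR Hd HT (A := X) (S := T)).
    * intros x Hx; exact Hx.
    * apply (subspace_whole HR Hd HT).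
    * apply (relclosed_cl HR Hd), cap_C_in_X.
  + destruct (nbhd_spec Hn) as [_ [[x [Hx HxC]] _]]; exists x.
    apply (subset_cl Hd); [apply cap_C_in_X | apply in_cap; auto].
- intros n m D E Hn Hm; apply is_succ_eq in Hm; subst m.
  rewrite !rel_lam by exact Ht; intros [_ ->] [_ ->].
  apply trace_decreasing, Hn.
- intros e _ He; destruct (h_lim He) as [m [Hm L]]; exists m.
  split; [exact Hm|]; intros n D Hn Hmn; rewrite rel_lam by exact Ht.
  intros [_ ->]; destruct (trace_diameter Hn) as [s [Hs Ls]]; exists s.
  split; [exact Hs|]; apply (le_lt_trans HR Ls).
  apply (le_lt_trans HR (h_dec Hn Hmn) L).
- exists x; intros n Hn; apply (Hx n); [exact Hn|].
  rewrite rel_lam by exact Ht; auto.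
Qed.

Lemma trace_inter_unique x y : (forall n, n ∈ omega -> x ∈ trace n) ->
  (forall n, n ∈ omega -> y ∈ trace n) -> x = y.
Proof.
intros Hx Hy.
pose proof (cl_in_X (Hx _ emp_in_omega)) as HxX.
pose proof (cl_in_X (Hy _ emp_in_omega)) as HyX.
apply (dist_eq0 Hd HxX HyX).
apply NNPP; intros Hne.
destruct (@h_lim (dist x y)) as [n [Hn L]].
- split; [apply (dist_ge0 Hd HxX HyX) | exact Hne].
- destruct (nbhd_spec Hn) as [_ [_ [_ [_ Hdiam]]]].
  apply (@lt_irrefl M R (h n)); apply (lt_le_trans HR L).
  apply Hdiam; apply trace_in; auto.
Qed.

Lemma limit_point_in : limit_point C ∈ C.
Proof.
destruct trace_inter as [x Hx].
assert (E : limit_point C = x).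
{ apply iota_eq; [exact Hx|]; intros y Hy; apply trace_inter_unique; assumption. }
rewrite E; apply HC.
- apply HA; split; [apply (cl_in_X (Hx _ emp_in_omega))|].
  intros U HU; destruct (nbhd_spec (idx_in HU)) as [_ [_ [_ [K _]]]].
  apply (K U HU eq_refl), trace_in, Hx, idx_in, HU.
- generalize (Hx _ emp_in_omega); apply cl_mono.
  intros y Hy; apply in_cap in Hy; apply Hy.
Qed.

End GDeltaChoice.

(** * Loeb and separable subspaces *)

Section Subspace.
Context {M : set_structure} {HM : models_ZF M}.
Context (R : real_structure M) (HR : is_real_field R).
Context (X d T : M) (Hd : is_metric R X d) (HT : metric_topology R X d T).
Variables (A S : M) (HAX : A ⊆ X) (HS : subspace_topology T A S).

Notation dist := (dist d).
Notation ball := (ball R X d).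
Notation cl := (cl R X d).
Notation relclosed := (relclosed R X d).

(** [f] is a definable choice function on the non-empty closed subsets of [A]. *)
Definition chooses (f : M -> M) : Prop :=
  T1 f /\ forall C, relclosed A C -> nonempty C -> f C ∈ C.

Lemma loeb_of_chooses (f : M -> M) : chooses f -> loeb A S.
Proof.
intros [Hf Hin].
set (K := sep (power A) (fun C => relclosed A C /\ nonempty C)).
assert (HK : forall C, C ∈ K <-> relclosed A C /\ nonempty C).
{ intros C; unfold K; rsep; rewrite in_power; split; [tauto|].
  intros H; split; [apply H | exact H]. }
exists K; split.
- intros C; rewrite HK, (relclosedE HR Hd HT C HAX HS); reflexivity.
- exists (union K), (lam K f); split; [intros x; apply in_union|]; split.
  + apply lam_function; [exact Hf|]; intros C HC; apply in_union; exists C.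
    split; [exact HC|]; apply HK in HC; apply Hin; apply HC.
  + intros C x HC; rewrite rel_lam by exact Hf; intros [_ ->].
    apply HK in HC; apply Hin; apply HC.
Qed.

Lemma chooses_of_loeb : loeb A S -> exists f, chooses f.
Proof.
intros [K [HK [u [f [Hu [Hf Hin]]]]]]; exists (app f); split; [df|].
intros C HC Hne.
assert (HCK : C ∈ K).
{ apply HK; rewrite (relclosedE HR Hd HT C HAX HS); auto. }
apply (Hin C (app f C) HCK), rel_op, (app_spec Hf HCK); reflexivity.
Qed.

(** The chosen points of the closures of the traces of the members of the base on
    [A] are dense in [A]; they are countably many because [f] also chooses from
    the finite subsets of [A], which are closed. *)
Lemma separable_of_chooses (f : M -> M) (B : M) (D : M -> M) : chooses f ->
  open_base T B -> T1 D -> (forall n, n ∈ omega -> Fin (D n)) ->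
  (forall W, W ∈ B <-> exists n, n ∈ omega /\ W ∈ D n) -> separable A S.
Proof.
intros [Hf Hin] HB HD Hfin HBD.
set (q := fun W => nonempty (cap W A)).
set (pt := fun W => f (cap (cl (cap W A)) A)).
assert (Hq : D1 q) by (unfold q; df).
assert (Hpt : T1 pt) by (unfold pt; df).
assert (Himg : forall E y, y ∈ img (sep E q) pt <->
  exists W, (W ∈ E /\ q W) /\ y = pt W).
{ intros E y; rimg; setoid_rewrite in_sep; [reflexivity | exact Hq]. }
assert (Hcap : forall W, cap W A ⊆ X).
{ intros W x Hx; apply in_cap in Hx; apply HAX, Hx. }
assert (Hp : forall W, q W -> pt W ∈ cl (cap W A) /\ pt W ∈ A).
{ intros W [x Hx]; apply in_cap, Hin.
  - apply (relclosed_cl_cap HR Hd HAX (Hcap W)).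
  - exists x; apply in_cap; split; [apply (subset_cl Hd (Hcap W) Hx)|].
    apply in_cap in Hx; apply Hx. }
exists (img (sep B q) pt); split; [|split].
- intros y Hy; apply Himg in Hy; destruct Hy as [W [[_ HW] ->]].
  apply Hp, HW.
- apply (@countable_union_of_finite M HM _
    (fun n => img (sep (D n) q) pt) f).
  + df.
  + exact Hf.
  + intros y; rewrite Himg; setoid_rewrite Himg; split.
    * intros [W [[HW qW] ->]]; apply HBD in HW; destruct HW as [n [Hn HW]]; eauto 7.
    * intros [n [Hn [W [[HW qW] ->]]]]; exists W; rewrite HBD; eauto 7.
  + intros n Hn; apply Fin_img; auto.
  + intros n Z Hn HZ Hne; apply Hin; [|exact Hne].
    apply (relclosed_Fin HR Hd HAX).
    * apply Fin_subset with (img (sep (D n) q) pt); [|exact HZ].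
      apply Fin_img; auto.
    * intros y Hy; apply HZ, Himg in Hy; destruct Hy as [W [[_ HW] ->]].
      apply Hp, HW.
- intros V HV [x Hx]; apply HS in HV; destruct HV as [U [HU E]].
  apply E in Hx; destruct Hx as [HxU HxA].
  destruct (proj2 (proj1 (openE HR Hd HT U) HU) x HxU) as [r [Hr L]].
  destruct (base_regular HR Hd HT HB (HAX HxA) Hr) as [W [HW [HxW HWr]]].
  assert (qW : q W) by (exists x; apply in_cap; auto).
  exists (pt W); split; [|apply Himg; eauto].
  destruct (Hp W qW) as [Hc HpA]; apply E; split; [|exact HpA].
  apply L, HWr; revert Hc; apply cl_mono; intros y Hy.
  apply in_cap in Hy; apply Hy.
Qed.

End Subspace.

(** * Bases with a choice function *)

Section Bases.
Context {M : set_structure} {HM : models_ZF M}.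
Context (R : real_structure M) (HR : is_real_field R).
Context (X d T : M) (Hd : is_metric R X d) (HT : metric_topology R X d T).

Notation dist := (dist d).
Notation ball := (ball R X d).

(** [sel] is a definable choice function on the non-empty subsets of [B]. *)
Definition selects (B : M) (sel : M -> M) : Prop :=
  T1 sel /\ forall Z, Z ⊆ B -> nonempty Z -> sel Z ∈ Z.

Lemma countable_selects (B : M) : countable B -> exists sel, selects B sel.
Proof.
intros HB; destruct (countable_inj HB) as [g [Hg [Hw Hinj]]].
exists (fun Z => iota (fun W => W ∈ Z /\
  g W = least (fun i => exists V, V ∈ Z /\ g V = i))); split; [df|].
intros Z HZ [W HW].
destruct (@least_spec M HM (fun i => exists V, V ∈ Z /\ g V = i))
  as [_ [[V [HV E]] _]].
- df.
- exists (g W); split; [apply Hw, HZ, HW | eauto].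
- apply (@iota_spec M HM (fun W => W ∈ Z /\
    g W = least (fun i => exists V, V ∈ Z /\ g V = i))).
  exists V; split; [auto|]; intros V' [HV' E'].
  apply Hinj; [apply HZ, HV | apply HZ, HV' | congruence].
Qed.

(** The balls with centres in a countable dense set and radii [h n] form a base;
    one of them is chosen by the least index of a centre, then the least radius
    index. *)
Lemma separable_selects : separable X T ->
  exists B sel, open_base T B /\ selects B sel.
Proof.
intros [N [HN [Hc Hdense]]].
destruct (countable_inj Hc) as [g [Hg [Hw Hinj]]].
destruct (small_sequence HR) as [h [Hh [Hpos [_ Hlim]]]].
set (B := sep T (fun U => exists x n, x ∈ N /\ n ∈ omega /\ U = ball x (h n))).
assert (HB : forall U, U ∈ B <->
  exists x n, x ∈ N /\ n ∈ omega /\ U = ball x (h n)).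
{ intros U; unfold B; rsep; split; [tauto|]; intros H; split; [|exact H].
  destruct H as [x [n [Hx [_ ->]]]]; apply (ball_open HR Hd HT); auto. }
set (hit := fun Z i => exists x, x ∈ N /\ g x = i /\
  exists n, n ∈ omega /\ ball x (h n) ∈ Z).
set (centre := fun Z => iota (fun x => x ∈ N /\ g x = least (hit Z))).
set (sel := fun Z =>
  ball (centre Z) (h (least (fun n => ball (centre Z) (h n) ∈ Z)))).
assert (Hcentre : T1 centre) by (unfold centre, hit; df).
exists B, sel; split; [|split].
- split; [intros U HU; unfold B in HU; rsep in HU; apply HU|].
  intros U HU; exists (sep B (fun V => V ⊆ U)); split.
  { intros V HV; rsep in HV; apply HV. }
  intros x; setoid_rewrite in_sep; [|df]; split.
  + intros Hx; destruct (proj1 (openE HR Hd HT U) HU) as [HUX K].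
    destruct (K x Hx) as [r [Hr L]]; pose proof (HUX x Hx) as HxX.
    destruct (Hlim _ (half_pos HR Hr)) as [n [Hn Ln]].
    destruct (Hdense (ball x (h n))) as [y [Hy HyN]].
    * apply (ball_open HR Hd HT _ HxX).
    * exists x; apply (ball_center Hd HxX (Hpos n Hn)).
    * apply in_ball in Hy; destruct Hy as [HyX Ly].
      assert (Ly' : Rlt R (dist y x) (h n))
        by (rewrite (dist_sym Hd HyX HxX); exact Ly).
      exists (ball y (h n)); split; [split|].
      -- apply HB; eauto 6.
      -- intros z Hz; apply in_ball in Hz; destruct Hz as [Hz Lz].
         apply L, in_ball; split; [exact Hz|].
         apply (dist_lt_half HR Hd (y := y) HxX HyX Hz);
           [apply (Rlt_in HR Hr) | apply (lt_le_trans HR Ly), Ln |].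
         apply (lt_le_trans HR Lz), Ln.
      -- apply in_ball; auto.
  + intros [V [[_ HV] Hx]]; auto.
- unfold sel; df.
- intros Z HZ [V HV].
  destruct (@least_spec M HM (hit Z)) as [_ [[x [Hx [E Hn]]] _]].
  + unfold hit; df.
  + pose proof (HZ V HV) as K; apply HB in K; destruct K as [x [n [Hx [Hn ->]]]].
    exists (g x); split; [auto|]; exists x; eauto.
  + assert (Ec : centre Z = x).
    { apply iota_eq; [auto|]; intros y [Hy E']; apply Hinj; auto; congruence. }
    unfold sel; rewrite Ec.
    apply (@least_spec M HM (fun n => ball x (h n) ∈ Z)); [df | exact Hn].
Qed.

End Bases.

(** * G-delta subspaces of Cantor complete spaces *)

Section Main.
Context {M : set_structure} {HM : models_ZF M}.
Context (R : real_structure M) (HR : is_real_field R).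
Context (X d T : M) (Hd : is_metric R X d) (HT : metric_topology R X d T).
Hypothesis Hcomplete : cantor_complete R X d.

(** Two bases are used: [B0] has a choice function, which makes [A] Loeb, and [B]
    is a countable union of finite sets, which makes [A] separable. *)
Lemma g_delta_loeb_separable (B0 B : M) (sel D : M -> M) (A S : M) :
  open_base T B0 -> selects B0 sel ->
  open_base T B -> T1 D -> (forall n, n ∈ omega -> Fin (D n)) ->
  (forall W, W ∈ B <-> exists n, n ∈ omega /\ W ∈ D n) ->
  g_delta X T A -> subspace_topology T A S -> loeb A S /\ separable A S.
Proof.
intros HB0 [Hsel Hsel_in] HB HD Hfin HBD [G [HG [HGc HA]]] HS.
destruct (countable_inj HGc) as [g [Hg [Hw Hinj]]].
destruct (small_sequence HR) as [h [Hh [Hpos [Hdec Hlim]]]].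
assert (HAX : A ⊆ X) by exact (fun x Hx => proj1 (proj1 (HA x) Hx)).
assert (Hf : chooses R X d A (limit_point R X d B0 sel G g h)).
{ split; [apply T1_limit_point; assumption|].
  intros C HC Hne; eapply limit_point_in; eassumption. }
split; [exact (loeb_of_chooses HR Hd HT HAX HS Hf)|].
exact (separable_of_chooses HR Hd HT HAX HS Hf HB HD Hfin HBD).
Qed.

End Main.

Theorem theorem2p9 (M : set_structure) (HM : models_ZF M)
    (R : real_structure M) (HR : is_real_field R)
    (X T : M) (HX : topological_space X T)
    (HC : cantor_completely_metrizable R X T) :
  (second_countable T ->
     forall A S : M, g_delta X T A -> subspace_topology T A S ->
       loeb A S /\ separable A S) /\
  (loeb X T -> has_cuf_base T ->
     forall A S : M, g_delta X T A -> subspace_topology T A S ->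
       loeb A S /\ separable A S).
Proof.
destruct HC as [d [Hd [Hcomplete HT]]]; split.
- intros [B [HB HBc]] A S HA HS.
  destruct (countable_selects HBc) as [sel Hsel].
  destruct (countable_family HBc) as [D [HD [Hfin HBD]]].
  exact (g_delta_loeb_separable HR Hd HT Hcomplete HB Hsel HB HD Hfin HBD HA HS).
- intros HL [B [HB HBc]] A S HA HS.
  destruct (cuf_family HBc) as [D [HD [Hfin HBD]]].
  assert (HXX : X ⊆ X) by (intros x Hx; exact Hx).
  pose proof (subspace_whole HR Hd HT) as HXT.
  destruct (chooses_of_loeb HR Hd HT HXX HXT HL) as [f Hf].
  pose proof (separable_of_chooses HR Hd HT HXX HXT Hf HB HD Hfin HBD) as Hsep.
  destruct (separable_selects HR Hd HT Hsep) as [B0 [sel [HB0 Hsel]]].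
  exact (g_delta_loeb_separable HR Hd HT Hcomplete HB0 Hsel HB HD Hfin HBD HA HS).
Qed.
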